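(* It is possible to construct a triple-well scenario with $TC(y,z)=4/9$ such that modifying the graph only slightly and arbitrarily far from the wells yields $TC(y,z)=1$. Precisely: for every $R\ge 1$ there exist finite connected graphs $G$ and $G'$, where $G'$ is obtained from $G$ by attaching one new vertex by a single new edge, and three vertices $x,y,z$ of $G$ such that the balls of radius $R$ around $\{x,y,z\}$ in $G$ and in $G'$ coincide, and for the simple triple-well potential $W=\chi_{\{x,y,z\}}$ one has $TC(y,z)=4/9$ in $G$ while $TC(y,z)=1$ in $G'$. Hence the tunneling coefficient is not determined by any fixed neighborhood of the wells.
   Context: For a finite connected graph $G=(X,E)$ with degrees $d_v$, the symmetrized Laplacian $\Delta$ has $\Delta(v,v)=1$, $\Delta(v,w)=-1/\sqrt{d_vd_w}$ if $vw\in E$, $0$ otherwise; $H=\Delta-QW$ with $W$ a diagonal matrix and $Q$ real. Starting from vertex $u$, the state is $\varphi_t=e^{itH}\chi_u$ ($\chi_u$ the indicator of $u$), depending on $Q$, and $TC(u,v)=\liminf_{Q\to\infty}\sup_{t\in[0,\infty)}|\varphi_t(v)|^2$. *)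

(* Defs.v *)
From HB Require Import structures.
From mathcomp Require Import all_boot all_order all_algebra.
From mathcomp Require Import all_classical all_reals all_analysis.
Set Implicit Arguments. Unset Strict Implicit. Unset Printing Implicit Defensive.
Import Order.TTheory GRing.Theory Num.Theory.
Import numFieldNormedType.Exports.
Local Open Scope classical_set_scope.
Local Open Scope ring_scope.

Definition simple_graph (T : finType) (e : rel T) : Prop :=
  symmetric e /\ irreflexive e.

Definition connected_graph (T : finType) (e : rel T) : Prop :=
  forall u v : T, connect e u v.

Definition attach (T : finType) (e : rel T) (v0 : T) : rel (option T) :=
  fun a b => match a, b with
  | Some a', Some b' => e a' b'
  | None, Some b' => b' == v0
  | Some a', None => a' == v0
  | None, None => false
  end.

Fixpoint gball (T : finType) (e : rel T) (r : nat) (S : {set T}) : {set T} :=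
  match r with
  | 0 => S
  | r'.+1 => let B := gball e r' S in B :|: [set w | [exists u in B, e u w]]
  end.

Section Tunneling.
Variables (R : realType) (T : finType) (e : rel T).

Definition deg (v : T) : R := #|[set w | e v w]|%:R.

Definition Lap (v w : T) : R :=
  if v == w then 1 else if e v w then - (Num.sqrt (deg v * deg w))^-1 else 0.

Definition Ham (Wp : T -> R) (Q : R) (v w : T) : R :=
  Lap v w - (if v == w then Q * Wp v else 0).

Fixpoint mpow (M : T -> T -> R) (n : nat) (v w : T) : R :=
  match n with
  | 0 => (v == w)%:R
  | n'.+1 => \sum_(c : T) M v c * mpow M n' c w
  end.

(* For real symmetric H, e^{itH} = cos(tH) + i sin(tH); the entry
   (e^{itH} chi_u)(v) = (e^{itH})(v,u) has real part
   sum_k (-1)^k t^(2k)/(2k)! H^(2k)(v,u) and imaginary part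
   sum_k (-1)^k t^(2k+1)/(2k+1)! H^(2k+1)(v,u). *)
Definition evol_re (M : T -> T -> R) (t : R) (u v : T) : R :=
  limn (series (fun k : nat =>
    (-1) ^+ k * t ^+ (k.*2) / (k.*2)`!%:R * mpow M k.*2 v u)).

Definition evol_im (M : T -> T -> R) (t : R) (u v : T) : R :=
  limn (series (fun k : nat =>
    (-1) ^+ k * t ^+ (k.*2.+1) / (k.*2.+1)`!%:R * mpow M k.*2.+1 v u)).

Definition prob (Wp : T -> R) (Q t : R) (u v : T) : R :=
  let H := Ham Wp Q in evol_re H t u v ^+ 2 + evol_im H t u v ^+ 2.

Definition supprob (Wp : T -> R) (u v : T) (Q : R) : \bar R :=
  ereal_sup [set (prob Wp Q t u v)%:E | t in [set t : R | 0 <= t]].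

Definition TC (Wp : T -> R) (u v : T) : \bar R :=
  limf_einf (supprob Wp u v) (@pinfty_nbhs R).

End Tunneling.

(* Main.v *)
Require Import Defs.
From HB Require Import structures.
From mathcomp Require Import all_boot all_order all_algebra perm.
From mathcomp Require Import all_classical all_reals all_analysis.
From mathcomp Require Import ring lra zify.
Set Implicit Arguments. Unset Strict Implicit. Unset Printing Implicit Defensive.
Import Order.TTheory GRing.Theory Num.Theory.
Import numFieldNormedType.Exports.
Local Open Scope classical_set_scope.
Local Open Scope ring_scope.

(** G is a triangle carrying three equal long arms, with a well in each arm.
    Let U = e^(itH) and let p, q be unit vectors supported on the wells.  If an
    eigenvector of energy l has squared overlap at least 1 - eps with p, then
    <p, U p> stays within O(eps) of e^(itl) for all times.

    In G the six arm permutations give 3 U(y,z) = <p, U p> - <q, U q>, with p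
    the normalized sum over the three wells and q = (chi_y - chi_z) / sqrt 2,
    whence |U(y,z)| <= 2/3.  The ground state (positive and simple by
    Perron-Frobenius, hence symmetric) is close to p and the lowest state odd
    under y <-> z is close to q; it has strictly larger energy, because it
    vanishes at x.  At t = pi / (energy gap) the two phases are opposite and the
    bound 2/3 is attained up to O(1/Q).

    G' lengthens the arm of x by one vertex.  Now 2 U(y,z) = <p, U p> - <q, U q>
    with p = (chi_y + chi_z) / sqrt 2, and it remains to see that the ground
    state w leaves x as Q grows.  For f = w / sqrt deg, the restrictions a, b of f
    to the arms of x and y satisfy the same three-term recurrence, so that
    a_j b_(j+1) - a_(j+1) b_j does not depend on j.  At the tip of the arms it is
    at least a b, which only loses a factor (2Q)^(2m) with respect to the wells
    at distance m; at the triangle it is at most a_0 b_1 <= Q^(-2m-1), since f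
    decays by a factor Q at every step away from the wells. *)

(** * Quadratic forms on a finite set and their constrained minimizers *)

Section QuadraticForms.
Context {R : realType} {T : finType}.
Implicit Types (M : T -> T -> R) (p q u v w : T -> R).

Definition dotp p q : R := \sum_a p a * q a.

Definition mulv M p : T -> R := fun a => \sum_b M a b * p b.

Lemma dotpC p q : dotp p q = dotp q p.
Proof. by apply: eq_bigr => a _; rewrite mulrC. Qed.

Lemma dotp_lin p u w (c : R) :
  dotp p (fun a => u a + c * w a) = dotp p u + c * dotp p w.
Proof.
by rewrite /dotp mulr_sumr -big_split /=; apply: eq_bigr => a _; ring.
Qed.

Lemma dotp_linl p u w (c : R) :
  dotp (fun a => u a + c * w a) p = dotp u p + c * dotp w p.
Proof. by rewrite dotpC dotp_lin (dotpC p u) (dotpC p w). Qed.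

Lemma dotpZr p u (c : R) : dotp p (fun a => c * u a) = c * dotp p u.
Proof. by rewrite /dotp mulr_sumr; apply: eq_bigr => a _; ring. Qed.

Lemma dotp_lin_sqr u w (c : R) :
  dotp (fun a => u a + c * w a) (fun a => u a + c * w a) =
  dotp u u + 2 * c * dotp u w + c ^+ 2 * dotp w w.
Proof. by rewrite dotp_lin !dotp_linl (dotpC w u); ring. Qed.

Lemma dotp_ge0 p : 0 <= dotp p p.
Proof. by apply: sumr_ge0 => a _; rewrite -expr2 sqr_ge0. Qed.

Lemma dotp_eq0 p : dotp p p = 0 -> forall a, p a = 0.
Proof.
move=> p0 a; apply/eqP; rewrite -sqrf_eq0 expr2; apply/eqP.
by apply: (psumr_eq0P _ p0) => // b _; rewrite -expr2 sqr_ge0.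
Qed.

Lemma dotp_coord_le p a : p a ^+ 2 <= dotp p p.
Proof.
rewrite /dotp (bigD1 a) //= expr2 lerDl.
by apply: sumr_ge0 => b _; rewrite -expr2 sqr_ge0.
Qed.

Lemma mulv_lin M u w (c : R) a :
  mulv M (fun a => u a + c * w a) a = mulv M u a + c * mulv M w a.
Proof.
by rewrite /mulv mulr_sumr -big_split /=; apply: eq_bigr => b _; ring.
Qed.

Lemma dotp_mulvC M p q : (forall a b, M a b = M b a) ->
  dotp p (mulv M q) = dotp q (mulv M p).
Proof.
move=> Msym; rewrite /dotp /mulv.
under eq_bigr do rewrite mulr_sumr.
rewrite exchange_big /=; apply: eq_bigr => a _; rewrite mulr_sumr.
by apply: eq_bigr => b _; rewrite Msym; ring.
Qed.

Lemma mulv_lin_form M u w (c : R) : (forall a b, M a b = M b a) ->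
  dotp (fun a => u a + c * w a) (mulv M (fun a => u a + c * w a)) =
  dotp u (mulv M u) + 2 * c * dotp w (mulv M u) + c ^+ 2 * dotp w (mulv M w).
Proof.
move=> Msym; have -> : mulv M (fun a => u a + c * w a) =
  (fun a => mulv M u a + c * mulv M w a) by apply/funext => a; rewrite mulv_lin.
by rewrite dotp_lin !dotp_linl (dotp_mulvC u w Msym); ring.
Qed.

(** The index type is free because three kinds of constraints occur: none ([void]), earlier
    eigenvectors (['I_k]), and oddness under an involution ([T]). *)
Definition orth {I : Type} (A : I -> T -> R) p : Prop :=
  forall i, dotp (A i) p = 0.

Lemma orth_lin {I : Type} (A : I -> T -> R) u w (c : R) :
  orth A u -> orth A w -> orth A (fun a => u a + c * w a).
Proof. by move=> Au Aw i; rewrite dotp_lin Au Aw mulr0 addr0. Qed.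

Lemma continuous_bigsum (X : topologicalType) (F : T -> X -> R) :
  (forall a, continuous (F a)) -> continuous (fun x => \sum_a F a x).
Proof.
move=> cF; apply: continuous_big => [|a _]; last exact: cF.
exact: add_continuous.
Qed.

Lemma continuous_dotp (X : topologicalType) (f g : X -> T -> R) :
  (forall a, continuous (fun x => f x a)) ->
  (forall a, continuous (fun x => g x a)) ->
  continuous (fun x => dotp (f x) (g x)).
Proof.
move=> cf cg; apply: (@continuous_bigsum X (fun a x => f x a * g x a)) => a x.
exact: (@continuousM _ X _ _ x (cf a x) (cg a x)).
Qed.

Lemma continuous_mulv M (X : topologicalType) (f : X -> T -> R) :
  (forall a, continuous (fun x => f x a)) ->
  forall a, continuous (fun x => mulv M (f x) a).
Proof.
move=> cf a; apply: (@continuous_dotp X (fun=> M a) f) => // b.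
exact: cst_continuous.
Qed.

(** The unit vectors satisfying the constraints form a closed subset of the cube [[-1, 1]^T],
    compact by Tychonoff; a minimizer there gives the bound for all [w] by homogeneity. *)
Lemma rayleigh_min M {I : Type} (A : I -> T -> R) w0 :
  orth A w0 -> dotp w0 w0 != 0 ->
  exists u, [/\ orth A u, dotp u u = 1 & forall w, orth A w ->
    dotp u (mulv M u) * dotp w w <= dotp w (mulv M w)].
Proof.
move=> Aw0 w00.
pose P := prod_topology (fun _ : T => R).
have cproj a : continuous (fun p : P => p a).
  exact: (@proj_continuous T (fun=> R) a).
have cdot q : continuous (fun p : P => dotp q p).
  by apply: (@continuous_dotp P (fun=> q) id) => // a; exact: cst_continuous.
have cnorm : continuous (fun p : P => dotp p p).
  exact: (@continuous_dotp P id id).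
have cform : continuous (fun p : P => dotp p (mulv M p)).
  apply: (@continuous_dotp P id (mulv M)) => //.
  exact: (@continuous_mulv M P id).
pose E : set P := [set p | dotp p p = 1 /\ orth A p].
have scaleE w : orth A w -> dotp w w != 0 ->
    E (fun a => (Num.sqrt (dotp w w))^-1 * w a).
  move=> Aw w1; split; last by move=> i; rewrite dotpZr Aw mulr0.
  rewrite dotpZr (dotpC _ w) dotpZr mulrA -expr2 exprVn sqr_sqrtr ?dotp_ge0 //.
  by rewrite mulVf.
have E0 : E !=set0 by eexists; exact: (scaleE w0).
have Ecl : closed E.
  have -> : E = [set p : P | dotp p p = 1] `&`
      \bigcap_(i in setT) [set p : P | dotp (A i) p = 0].
    by apply/seteqP; split => p [p1 pA]; split => // i; [move=> _|]; exact: pA.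
  apply: closedI.
    by apply: (@preimage_closed P R (fun p : P => dotp p p) [set 1]);
      [move=> p _; exact: cnorm|exact: closed_eq].
  apply: closed_bigI => i _.
  by apply: (@preimage_closed P R (dotp (A i)) [set 0]);
    [move=> p _; exact: cdot|exact: closed_eq].
have Eco : compact E.
  apply: (subclosed_compact Ecl (@tychonoff T (fun=> R) (fun=> `[-1, 1]%classic) _)).
    by move=> _; exact: segment_compact.
  move=> p [p1 _] a /=; have := dotp_coord_le p a; rewrite p1 => pa.
  by rewrite in_itv /=; apply/andP; split; nra.
have cw : {within E, continuous (fun p : P => dotp p (mulv M p))}.
  exact: continuous_subspaceT.
have [u /set_mem[u1 Au] umin] := compact_EVT_min E0 Eco cw.
exists u; split => // w Aw.
have [w1|w1] := eqVneq (dotp w w) 0.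
  rewrite w1 mulr0 /dotp big1 // => a _.
  by rewrite (dotp_eq0 w1) mul0r.
have := umin _ (mem_set (scaleE _ Aw w1)).
set c := (Num.sqrt _)^-1.
have cw2 : c ^+ 2 * dotp w w = 1.
  by rewrite /c exprVn sqr_sqrtr ?dotp_ge0 // mulVf.
have -> : dotp (fun a => c * w a) (mulv M (fun a => c * w a)) =
          c ^+ 2 * dotp w (mulv M w).
  rewrite /dotp mulr_sumr; apply: eq_bigr => a _.
  by rewrite /mulv !mulr_sumr; apply: eq_bigr => b _; ring.
move=> h; have := ler_wpM2r (dotp_ge0 w) h.
by rewrite mulrAC cw2 mul1r.
Qed.

(** First-order condition at a minimum: [h = M u - l u] again satisfies the constraints, and moving
    to [u + t h] changes the form minus [l] times the squared norm by [2 t |h|^2] at first order, so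
    [h] must vanish. *)
Lemma eigen_of_min M {I : Type} (A : I -> T -> R) (l : R) u :
  (forall a b, M a b = M b a) ->
  (forall w, orth A w -> orth A (mulv M w)) ->
  (forall w, orth A w -> l * dotp w w <= dotp w (mulv M w)) ->
  orth A u -> dotp u (mulv M u) <= l * dotp u u ->
  forall a, mulv M u a = l * u a.
Proof.
move=> Msym Minv lmin Au ul.
pose h a := mulv M u a + - l * u a.
have Ah : orth A h by apply: orth_lin => //; exact: Minv.
suff h0 : dotp h h = 0.
  by move=> a; have := dotp_eq0 h0 a; rewrite /h; lra.
have lh := lmin h Ah.
set B := dotp h (mulv M h) - l * dotp h h.
have B0 : 0 <= B by rewrite /B; lra.
have D0 := dotp_ge0 h; set D := dotp h h in D0 lh *.
(* Adding 1 to [B >= 0] avoids a zero denominator; with this [t] the inequality becomes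
   [D ^+ 2 * (2 + B) <= 0]. *)
pose t := - D / (1 + B).
have := lmin _ (orth_lin t Au Ah).
rewrite mulv_lin_form // dotp_lin_sqr.
have hD : dotp h (mulv M u) - l * dotp u h = D.
  have -> : D = dotp h (mulv M u) + - l * dotp h u by rewrite -dotp_lin.
  by rewrite (dotpC u h); ring.
move=> ineq.
have : 0 <= 2 * t * D + t ^+ 2 * B by rewrite -hD /B; lra.
have tB : t * (1 + B) = - D by rewrite /t divfK //; lra.
move=> pos; have : D ^+ 2 * (2 + B) <= 0; last by nra.
have : 0 <= (2 * t * D + t ^+ 2 * B) * (1 + B) ^+ 2.
  by rewrite mulr_ge0 // sqr_ge0.
have -> : (2 * t * D + t ^+ 2 * B) * (1 + B) ^+ 2 =
  2 * (t * (1 + B)) * D * (1 + B) + (t * (1 + B)) ^+ 2 * B by ring.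
by rewrite tB; nra.
Qed.
End QuadraticForms.

(** * Eigenbases and the propagator expanded in them *)

Section Spectral.
Context {R : realType} {T : finType}.
Implicit Types (M : T -> T -> R) (p q u v w : T -> R).

(** Only indices below [k] count; total functions on [nat] let a family grow by a plain [if]. *)
Definition eigenfam M k (lam : nat -> R) (psi : nat -> T -> R) : Prop :=
  (forall i, (i < k)%N -> forall a, mulv M (psi i) a = lam i * psi i a) /\
  (forall i j, (i < k)%N -> (j < k)%N -> dotp (psi i) (psi j) = (i == j)%:R).

(** For orthonormal [psi], what the projection onto their span leaves of [p]; its vanishing for all
    [p] expresses completeness. *)
Definition residue k (psi : nat -> T -> R) p : T -> R :=
  fun a => p a - \sum_(i < k) dotp (psi i) p * psi i a.

Lemma dotp_residue k psi p q :
  dotp q (residue k psi p) =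
  dotp q p - \sum_(i < k) dotp (psi i) p * dotp (psi i) q.
Proof.
rewrite /residue /dotp.
under eq_bigr do rewrite mulrBr mulr_sumr.
rewrite sumrB; congr (_ - _); rewrite exchange_big; apply: eq_bigr => i _ /=.
by rewrite mulr_sumr; apply: eq_bigr => a _; ring.
Qed.

Lemma residue_orth M k lam psi p j : eigenfam M k lam psi -> (j < k)%N ->
  dotp (psi j) (residue k psi p) = 0.
Proof.
move=> H jk; rewrite (dotp_residue k psi p (psi j)).
rewrite (bigD1 (Ordinal jk)) //= big1 ?addr0 => [|i ij].
  by rewrite H.2 // eqxx mulr1 subrr.
by rewrite H.2 //= (negbTE (ij : (i : nat) != j)) mulr0.
Qed.

Lemma bessel M k lam psi p : eigenfam M k lam psi ->
  \sum_(i < k) dotp (psi i) p ^+ 2 <= dotp p p.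
Proof.
move=> H; have := dotp_ge0 (residue k psi p).
rewrite dotp_residue.
under eq_bigr => i _ do rewrite (residue_orth p H (ltn_ord i)) mulr0.
rewrite big1 // subr0 dotpC dotp_residue subr_ge0.
by under eq_bigr do rewrite -expr2.
Qed.

Definition ptmass (a : T) : T -> R := fun b => (b == a)%:R.

Lemma dotp_ptmass p a : dotp p (ptmass a) = p a.
Proof.
rewrite /dotp (bigD1 a) //= /ptmass eqxx mulr1 big1 ?addr0 // => b /negbTE->.
by rewrite mulr0.
Qed.

(** Bessel's inequality for a point mass, summed over all vertices. *)
Lemma eigenfam_size M k lam psi : eigenfam M k lam psi -> (k <= #|T|)%N.
Proof.
move=> H; rewrite -(ler_nat R).
have -> : k%:R = \sum_(i < k) dotp (psi i) (psi i) :> R.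
  transitivity (\sum_(i < k) 1 : R); last first.
    by apply: eq_bigr => i _; rewrite H.2 // eqxx.
  by rewrite sumr_const card_ord.
rewrite /dotp exchange_big /=.
have -> : #|T|%:R = \sum_(a : T) 1 :> R by rewrite sumr_const.
apply: ler_sum => a _.
have <- : \sum_(i < k) dotp (psi i) (ptmass a) ^+ 2 = \sum_(i < k) psi i a * psi i a.
  by apply: eq_bigr => i _; rewrite dotp_ptmass expr2.
by have := bessel (ptmass a) H; rewrite [leRHS]dotp_ptmass {2}/ptmass eqxx.
Qed.

(** Symmetry makes [M] preserve the orthogonal complement of the family; a minimizer of the form
    there is a new eigenvector. *)
Lemma eigenfam_extend M k lam psi p : (forall a b, M a b = M b a) ->
  eigenfam M k lam psi ->
  dotp (residue k psi p) (residue k psi p) != 0 ->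
  exists l u, eigenfam M k.+1 (fun i => if (i < k)%N then lam i else l)
                              (fun i => if (i < k)%N then psi i else u).
Proof.
move=> Msym H res0; pose A (i : 'I_k) := psi i.
have Ares : orth A (residue k psi p).
  by move=> i; exact: (residue_orth p H (ltn_ord i)).
have [u [Au u1 umin]] := rayleigh_min M Ares res0.
have Minv w : orth A w -> orth A (mulv M w).
  move=> Aw i; rewrite dotp_mulvC //.
  have -> : mulv M (A i) = (fun a => lam i * A i a).
    by apply/funext => a; exact: H.1.
  by rewrite dotpZr dotpC Aw mulr0.
have ueig := eigen_of_min Msym Minv umin Au.
exists (dotp u (mulv M u)), u; split => [i ik a|i j ik jk].
  case: ifP => ik'; first by rewrite H.1.
  by apply: ueig; rewrite u1 mulr1.
case: ifP => ik'; case: ifP => jk'.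
- exact: H.2.
- by rewrite (Au (Ordinal ik')); case: eqVneq => // ij; lia.
- by rewrite dotpC (Au (Ordinal jk')); case: eqVneq => // ij; lia.
- by rewrite u1; case: eqVneq => // ij; lia.
Qed.

(** Extension stops because orthonormal families have at most [#|T|] members. Keeping the given
    family as an initial segment allows a known eigenvector to sit at index 0 of an eigenbasis. *)
Lemma eigenfam_complete M k lam psi : (forall a b, M a b = M b a) ->
  eigenfam M k lam psi ->
  exists k' lam' psi', [/\ eigenfam M k' lam' psi', (k <= k')%N,
    forall i, (i < k)%N -> lam' i = lam i /\ psi' i = psi i &
    forall p a, residue k' psi' p a = 0].
Proof.
move=> Msym; move En : (#|T| - k)%N => n.
elim: n k lam psi En => [|n IH] k lam psi En H;
  have [cpl|/existsNP[p /eqP ncpl]] :=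
    pselect (forall p, dotp (residue k psi p) (residue k psi p) = 0).
- by exists k, lam, psi; split => // p a; exact: dotp_eq0.
- have [l [u H']] := eigenfam_extend Msym H ncpl.
  by have := eigenfam_size H'; lia.
- by exists k, lam, psi; split => // p a; exact: dotp_eq0.
- have [l [u H']] := eigenfam_extend Msym H ncpl.
  have [|k' [lam' [psi' [H2 kk' ext cpl]]]] := IH _ _ _ _ H'; first by lia.
  exists k', lam', psi'; split => //; first by lia.
  by move=> i ik; have [|-> ->] := ext i; [lia|rewrite ik].
Qed.

Lemma mpow_spectral M k lam psi : eigenfam M k lam psi ->
  (forall p a, residue k psi p a = 0) ->
  forall n a b, mpow M n a b = \sum_(i < k) lam i ^+ n * (psi i a * psi i b).
Proof.
move=> H cpl; elim=> [|n IH] a b /=.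
  have /subr0_eq := cpl (ptmass b) a; rewrite {1}/ptmass => ->.
  by apply: eq_bigr => i _; rewrite dotp_ptmass expr0; ring.
under eq_bigr do rewrite IH mulr_sumr.
rewrite exchange_big /=; apply: eq_bigr => i _.
transitivity (lam i ^+ n * psi i b * mulv M (psi i) a).
  by rewrite /mulv mulr_sumr; apply: eq_bigr => c _; ring.
by rewrite H.1 // exprS; ring.
Qed.

Lemma limn_series_sum k (c : nat -> R) (f : nat -> R^nat) (l : nat -> R)
    (g : R^nat) :
  (forall i, (i < k)%N -> series (f i) @ \oo --> l i) ->
  (forall n, g n = \sum_(i < k) f i n * c i) ->
  limn (series g) = \sum_(i < k) l i * c i.
Proof.
move=> fl gE; apply/cvg_lim => //.
have -> : series g = (fun N => \sum_(i < k) series (f i) N * c i).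
  apply/funext => N; rewrite /series /=.
  under eq_bigr do rewrite gE.
  rewrite exchange_big /=; apply: eq_bigr => i _.
  by rewrite mulr_suml.
apply: cvg_big => [|i _]; first exact: add_continuous.
by apply: cvgM; [exact: fl|exact: cvg_cst].
Qed.

Lemma evol_re_spectral M k lam psi : eigenfam M k lam psi ->
  (forall p a, residue k psi p a = 0) -> forall t a b,
  evol_re M t b a = \sum_(i < k) cos (t * lam i) * (psi i a * psi i b).
Proof.
move=> H cpl t a b; rewrite /evol_re.
apply: (@limn_series_sum k (fun i => psi i a * psi i b)
  (fun i => cos_coeff' (t * lam i)) (fun i => cos (t * lam i))).
  by move=> i _; exact: cvg_cos_coeff'.
move=> n; rewrite (mpow_spectral H cpl) mulr_sumr; apply: eq_bigr => i _.
rewrite /cos_coeff' exprMn -exprnP; ring.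
Qed.

Lemma evol_im_spectral M k lam psi : eigenfam M k lam psi ->
  (forall p a, residue k psi p a = 0) -> forall t a b,
  evol_im M t b a = \sum_(i < k) sin (t * lam i) * (psi i a * psi i b).
Proof.
move=> H cpl t a b; rewrite /evol_im.
apply: (@limn_series_sum k (fun i => psi i a * psi i b)
  (fun i => sin_coeff' (t * lam i)) (fun i => sin (t * lam i))).
  by move=> i _; exact: cvg_sin_coeff'.
move=> n; rewrite (mpow_spectral H cpl) mulr_sumr; apply: eq_bigr => i _.
rewrite /sin_coeff' exprMn -exprnP; ring.
Qed.

Lemma evol_reC M t a b : (forall a b, M a b = M b a) ->
  evol_re M t a b = evol_re M t b a.
Proof.
move=> Msym; have H0 : eigenfam M 0 (fun=> 0) (fun=> fun=> 0) by split.
have [k [lam [psi [H _ _ cpl]]]] := eigenfam_complete Msym H0.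
by rewrite !(evol_re_spectral H cpl); apply: eq_bigr => i _; ring.
Qed.

Lemma evol_imC M t a b : (forall a b, M a b = M b a) ->
  evol_im M t a b = evol_im M t b a.
Proof.
move=> Msym; have H0 : eigenfam M 0 (fun=> 0) (fun=> fun=> 0) by split.
have [k [lam [psi [H _ _ cpl]]]] := eigenfam_complete Msym H0.
by rewrite !(evol_im_spectral H cpl); apply: eq_bigr => i _; ring.
Qed.

Definition qform p (U : T -> T -> R) : R := dotp p (mulv U p).

Lemma qform_rank1_sum p k (c : nat -> R) (psi : nat -> T -> R) U :
  (forall a b, U a b = \sum_(i < k) c i * (psi i a * psi i b)) ->
  qform p U = \sum_(i < k) c i * dotp (psi i) p ^+ 2.
Proof.
move=> UE; rewrite /qform {1}/dotp /mulv.
under eq_bigr => a _ do rewrite mulr_sumr.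
under eq_bigr => a _ do under eq_bigr => b _ do rewrite UE mulr_suml mulr_sumr.
under eq_bigr => a _ do rewrite exchange_big /=.
rewrite exchange_big /=; apply: eq_bigr => i _.
rewrite expr2 {1}/dotp mulr_suml mulr_sumr; apply: eq_bigr => a _.
by rewrite /dotp !mulr_sumr; apply: eq_bigr => b _; ring.
Qed.

(** [q i] is the squared overlap of [p] with the [i]-th member of an eigenbasis that begins with
    [w]; the total weight comes from completeness. *)
Lemma spectral_measure M p (l : R) w : (forall a b, M a b = M b a) ->
  dotp w w = 1 -> (forall a, mulv M w a = l * w a) ->
  exists k (d q : nat -> R), [/\ forall i, 0 <= q i,
    \sum_(i < k.+1) q i = dotp p p, d 0%N = l /\ q 0%N = dotp w p ^+ 2,
    forall t, qform p (fun a b => evol_re M t b a) =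
              \sum_(i < k.+1) cos (t * d i) * q i &
    forall t, qform p (fun a b => evol_im M t b a) =
              \sum_(i < k.+1) sin (t * d i) * q i].
Proof.
move=> Msym w1 weig.
have H1 : eigenfam M 1 (fun=> l) (fun=> w).
  by split => [i _ a|[|i] [|j]] //.
have [[|k] [d [psi [H //]]]] := eigenfam_complete Msym H1.
move=> _ /(_ 0%N isT)[d0 psi0] cpl.
exists k, d, (fun i => dotp (psi i) p ^+ 2); split.
- by move=> i; exact: sqr_ge0.
- have : dotp p (residue k.+1 psi p) = 0.
    by rewrite /dotp big1 // => a _; rewrite cpl mulr0.
  rewrite dotp_residue => /subr0_eq ->.
  by apply: eq_bigr => i _; rewrite expr2.
- by rewrite d0 psi0.
- move=> t; apply: (qform_rank1_sum _ (c := fun i => cos (t * d i))) => a b.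
  exact: (evol_re_spectral H cpl).
- move=> t; apply: (qform_rank1_sum _ (c := fun i => sin (t * d i))) => a b.
  exact: (evol_im_spectral H cpl).
Qed.
End Spectral.

(** * Interference of two energy levels *)

Section TwoLevel.
Context {R : realType}.

(** Pairing the mixture [C + i S] with a unit phase gives at most [(C^2 + S^2 + 1) / 2]; averaging
    bounds [C^2 + S^2] by that same quantity, hence by 1. *)
Lemma phase_mix_le1 k (d q : nat -> R) t : (forall i, 0 <= q i) ->
  \sum_(i < k) q i = 1 ->
  (\sum_(i < k) cos (t * d i) * q i) ^+ 2 +
  (\sum_(i < k) sin (t * d i) * q i) ^+ 2 <= 1.
Proof.
move=> q0 q1.
have amgm (x y c s : R) : c ^+ 2 + s ^+ 2 = 1 ->
    x * c + y * s <= (x ^+ 2 + y ^+ 2 + 1) / 2.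
  by move=> cs; have := sqr_ge0 (x - c); have := sqr_ge0 (y - s); lra.
set C := \sum_(i < k) cos _ * _; set S := \sum_(i < k) sin _ * _.
suff : C ^+ 2 + S ^+ 2 <= (C ^+ 2 + S ^+ 2 + 1) / 2 * \sum_(i < k) q i.
  by rewrite q1; lra.
have NE : C ^+ 2 + S ^+ 2 =
    \sum_(i < k) (C * cos (t * d i) + S * sin (t * d i)) * q i.
  rewrite !expr2 {2}/C {2}/S !mulr_sumr -big_split /=.
  by apply: eq_bigr => i _; ring.
rewrite [leLHS]NE mulr_sumr.
apply: ler_sum => i _; apply: ler_wpM2r => //.
exact/amgm/cos2Dsin2.
Qed.

(** In the direction of the phase of index 0, that term contributes [q 0] and every other at least
    [- q i]; the others weigh [1 - q 0] in total. *)
Lemma phase_mix_ge k (d q : nat -> R) t : (forall i, 0 <= q i) ->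
  \sum_(i < k.+1) q i = 1 ->
  2 * q 0%N - 1 <= (\sum_(i < k.+1) cos (t * d i) * q i) * cos (t * d 0%N) +
                   (\sum_(i < k.+1) sin (t * d i) * q i) * sin (t * d 0%N).
Proof.
have amgm (x y c s : R) : x ^+ 2 + y ^+ 2 = 1 -> c ^+ 2 + s ^+ 2 = 1 ->
    - 1 <= x * c + y * s.
  by move=> xy cs; have := sqr_ge0 (x + c); have := sqr_ge0 (y + s); lra.
move=> q0; rewrite !mulr_suml -big_split /= !big_ord_recl /= => q1.
have -> : 2 * q 0%N - 1 = q 0%N - \sum_(i < k) q (bump 0 i).
  by move: q1; move: (\sum_(i < k) _) => r; lra.
apply: lerD.
  rewrite mulrAC (mulrAC (sin _)) -mulrDl -!expr2 cos2Dsin2 mul1r //.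
rewrite -sumrN; apply: ler_sum => i _.
rewrite mulrAC (mulrAC (sin _)) -mulrDl -mulN1r; apply: ler_wpM2r => //.
exact: (amgm _ _ _ _ (cos2Dsin2 _) (cos2Dsin2 _)).
Qed.

Context {T : finType}.
Implicit Types (M : T -> T -> R) (p w : T -> R).

(** Both normalized forms lie in the unit disk, so their difference has modulus at most 2. Each has
    a component at least [1 - 2 * eps] along its own phase, which makes the difference almost 2 once
    the phases are opposite. *)
Lemma two_level M p1 p2 (l1 l2 : R) w1 w2 (kap eps : R) (u v : T) :
  (forall a b, M a b = M b a) -> l1 < l2 ->
  dotp w1 w1 = 1 -> (forall a, mulv M w1 a = l1 * w1 a) ->
  dotp w2 w2 = 1 -> (forall a, mulv M w2 a = l2 * w2 a) ->
  0 < dotp p1 p1 -> 0 < dotp p2 p2 -> eps <= 2^-1 ->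
  (1 - eps) * dotp p1 p1 <= dotp w1 p1 ^+ 2 ->
  (1 - eps) * dotp p2 p2 <= dotp w2 p2 ^+ 2 ->
  (forall t, kap * evol_re M t u v =
    qform p1 (fun a b => evol_re M t b a) / dotp p1 p1 -
    qform p2 (fun a b => evol_re M t b a) / dotp p2 p2) ->
  (forall t, kap * evol_im M t u v =
    qform p1 (fun a b => evol_im M t b a) / dotp p1 p1 -
    qform p2 (fun a b => evol_im M t b a) / dotp p2 p2) ->
  (forall t, kap ^+ 2 * (evol_re M t u v ^+ 2 + evol_im M t u v ^+ 2) <= 4) /\
  (exists2 t, 0 <= t & (2 - 4 * eps) ^+ 2 <=
    kap ^+ 2 * (evol_re M t u v ^+ 2 + evol_im M t u v ^+ 2)).
Proof.
move=> Msym l12 w11 e1 w21 e2 p10 p20 eps2 h1 h2 kre kim.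
have norm (p : T -> R) (l : R) (w : T -> R) : dotp w w = 1 ->
    (forall a, mulv M w a = l * w a) -> 0 < dotp p p ->
    (1 - eps) * dotp p p <= dotp w p ^+ 2 -> forall t,
  let C := qform p (fun a b => evol_re M t b a) / dotp p p in
  let S := qform p (fun a b => evol_im M t b a) / dotp p p in
  C ^+ 2 + S ^+ 2 <= 1 /\ 1 - 2 * eps <= C * cos (t * l) + S * sin (t * l).
  move=> w_1 we p0 h t.
  have [k [d [q [q0 q1 [d0 q00] Cq Sq]]]] := spectral_measure p Msym w_1 we.
  rewrite /= Cq Sq.
  pose q' i := q i / dotp p p.
  have q'0 i : 0 <= q' i by rewrite divr_ge0 // ltW.
  have q'1 : \sum_(i < k.+1) q' i = 1.
    by rewrite -mulr_suml q1 divff // gt_eqF.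
  have -> : (\sum_(i < k.+1) cos (t * d i) * q i) / dotp p p =
            \sum_(i < k.+1) cos (t * d i) * q' i.
    by rewrite mulr_suml; apply: eq_bigr => i _; rewrite -mulrA.
  have -> : (\sum_(i < k.+1) sin (t * d i) * q i) / dotp p p =
            \sum_(i < k.+1) sin (t * d i) * q' i.
    by rewrite mulr_suml; apply: eq_bigr => i _; rewrite -mulrA.
  split; first exact: phase_mix_le1.
  rewrite -d0; apply: le_trans (phase_mix_ge _ _ q'0 q'1).
  have : 1 - eps <= q' 0%N by rewrite /q' ler_pdivlMr // q00.
  by lra.
have n1 := norm p1 l1 w1 w11 e1 p10 h1.
have n2 := norm p2 l2 w2 w21 e2 p20 h2.
split=> [t|].
  rewrite mulrDr -!exprMn kre kim.
  have [/= + _] := n1 t; have [/= + _] := n2 t.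
  move: (qform p1 _ / _) (qform p2 _ / _) (qform p1 _ / _) (qform p2 _ / _).
  move=> C1 C2 S1 S2 h2' h1'.
  by have := sqr_ge0 (C1 + C2); have := sqr_ge0 (S1 + S2); lra.
exists (pi / (l2 - l1)); first by rewrite divr_ge0 ?pi_ge0 // subr_ge0 ltW.
set t := pi / _; rewrite mulrDr -!exprMn kre kim.
have tl : t * l2 = t * l1 + pi.
  by rewrite /t; field; rewrite subr_eq0 gt_eqF.
have [/= _] := n1 t; have [/= _] := n2 t; rewrite tl cosDpi sinDpi.
move: (qform p1 _ / _) (qform p2 _ / _) (qform p1 _ / _) (qform p2 _ / _).
move=> S1 S2 C1 C2; have := cos2Dsin2 (t * l1).
move: (cos _) (sin _) => c s cs h2' h1'.
(* [X] is the component of the difference along the phase of [l1]; the phase of [l2] being its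
   negative, the two lower bounds add up. [eps <= 2^-1] keeps [2 - 4 * eps] nonnegative for
   squaring. *)
pose X := (C1 - C2) * c + (S1 - S2) * s.
have X2 : 2 - 4 * eps <= X by rewrite /X; lra.
apply: (@le_trans _ _ (X ^+ 2)); first by rewrite ler_sqr ?nnegrE; lra.
have -> : (C1 - C2) ^+ 2 + (S1 - S2) ^+ 2 =
  X ^+ 2 + ((C1 - C2) * s - (S1 - S2) * c) ^+ 2 by rewrite -[LHS]mulr1 -cs /X; ring.
by rewrite lerDl sqr_ge0.
Qed.

(** The lower limit is a supremum of infima over neighbourhoods of infinity: the upper bound needs
    one large [Q] in each neighbourhood, the lower bound one neighbourhood where [K / Q] is
    small. *)
Lemma TC_eq (e : rel T) (Wp : T -> R) (u v : T) (c K Q0 : R) :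
  (forall Q, Q0 <= Q -> forall t, prob e Wp Q t u v <= c) ->
  (forall Q, Q0 <= Q -> exists2 t, 0 <= t & c - K / Q <= prob e Wp Q t u v) ->
  TC e Wp u v = c%:E.
Proof.
move=> ub lb; rewrite /TC limf_einfE; apply/eqP; rewrite eq_le; apply/andP; split.
  apply: ge_ereal_sup => _ [V [A [Areal AV]] <-].
  pose Q := Num.max Q0 (A + 1).
  apply: (@le_trans _ _ (supprob e Wp u v Q)).
    apply: ereal_inf_lbound; exists Q => //; apply: AV.
    by rewrite /Q lt_max ltrDl ltr01 orbT.
  apply: ge_ereal_sup => _ [t _ <-]; rewrite lee_fin.
  by apply: ub; rewrite /Q le_max lexx.
apply/lee_addgt0Pr => eps eps0.
(* Above [A], [Q] exceeds [Q0], is positive, and satisfies [K / Q <= eps]. *)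
pose A := Num.max Q0 (Num.max 1 (K / eps)).
apply: (@le_trans _ _ ((c - eps)%:E + eps%:E)%E).
  by rewrite -EFinD lee_fin; lra.
rewrite leeD2r //.
apply: (@le_trans _ _ (ereal_inf (supprob e Wp u v @` [set Q | A < Q]))).
  apply: le_ereal_inf_tmp => _ [Q /= AQ <-].
  move: AQ; rewrite /A !gt_max => /and3P[Q0Q Q1 KQ].
  have [t t0 h] := lb Q (ltW Q0Q).
  apply: (@le_trans _ _ (prob e Wp Q t u v)%:E).
    rewrite lee_fin; apply: le_trans h; rewrite lerD2l lerN2.
    rewrite ler_pdivrMr; last by lra.
    by rewrite mulrC -ler_pdivrMr // ltW.
  by apply: ereal_sup_ubound; exists t.
apply: ereal_sup_ubound; exists [set Q | A < Q] => //.
exists A; split => //; exact: num_real.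
Qed.
End TwoLevel.

(** * Perron-Frobenius theory of the ground state, and odd states *)

Section GroundStates.
Context {R : realType} {T : finType}.
Implicit Types (M : T -> T -> R) (p q u v w : T -> R).

Lemma connect_invariant (e : rel T) (P : T -> Prop) (a b : T) :
  (forall c d, e c d -> P c -> P d) -> connect e a b -> P a -> P b.
Proof.
move=> eP /connectP[s +->]; elim: s a => //= c s IH a /andP[ac cs] Pa.
exact/IH/(eP _ _ ac).
Qed.

Definition offdiag_nonpos M := forall a b, a != b -> M a b <= 0.

(** Diagonal terms do not see signs, and with a nonpositive off-diagonal coefficient, replacing
    [u a * u b] by its absolute value can only lower the term. *)
Lemma abs_form_le M u : offdiag_nonpos M ->
  dotp (fun a => `|u a|) (mulv M (fun a => `|u a|)) <= dotp u (mulv M u).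
Proof.
move=> Mneg; rewrite /dotp /mulv.
apply: ler_sum => a _; rewrite !mulr_sumr; apply: ler_sum => b _.
have [<-|ab] := eqVneq a b.
  by rewrite mulrCA -normrM mulrCA ger0_norm // -expr2 sqr_ge0.
rewrite mulrCA -normrM [leRHS]mulrCA; apply: ler_wnM2l; first exact: Mneg.
exact: ler_norm.
Qed.

Lemma dotp_abs u : dotp (fun a => `|u a|) (fun a => `|u a|) = dotp u u.
Proof. by apply: eq_bigr => a _; rewrite -normrM ger0_norm // -expr2 sqr_ge0. Qed.

Lemma dotp_eigen M (l : R) u : (forall a, mulv M u a = l * u a) ->
  dotp u (mulv M u) = l * dotp u u.
Proof. by move=> h; rewrite -dotpZr; apply: eq_bigr => a _; rewrite h. Qed.

Variables (M : T -> T -> R) (e : rel T).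
Hypotheses (Msym : forall a b, M a b = M b a) (Mneg : offdiag_nonpos M)
  (Me : forall a b, e a b -> M a b < 0)
  (econ : connected_graph e).

Lemma abs_ground (l : R) u :
  (forall w, l * dotp w w <= dotp w (mulv M w)) ->
  dotp u (mulv M u) <= l * dotp u u ->
  forall a, mulv M (fun a => `|u a|) a = l * `|u a|.
Proof.
move=> lmin ul; pose A (i : void) : T -> R := of_void _ i.
have A0 w : orth A w by case.
apply: (eigen_of_min Msym (fun w _ => A0 (mulv M w)) (fun w _ => lmin w) (A0 _)).
by rewrite dotp_abs; apply: le_trans ul; exact: abs_form_le.
Qed.

(** At a zero of [|u|] the eigenvalue equation is a vanishing sum of nonpositive terms, so [u]
    vanishes at all neighbours, and by connectedness everywhere. Positivity, symmetry and the strict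
    gap below all follow from this. *)
Lemma ground_vanish (l : R) u b :
  (forall w, l * dotp w w <= dotp w (mulv M w)) ->
  dotp u (mulv M u) <= l * dotp u u -> u b = 0 -> forall a, u a = 0.
Proof.
move=> lmin ul ub a; have eig := abs_ground lmin ul.
apply: (connect_invariant (P := fun a => u a = 0) _ (econ b a) ub).
move=> c d ecd uc; have := eig c; rewrite uc normr0 mulr0 /mulv => /eqP.
rewrite -oppr_eq0 -sumrN => /eqP s0.
have := psumr_eq0P _ s0 (i := d) isT => /(_ _)/eqP.
rewrite oppr_eq0 mulf_eq0 normr_eq0 lt_eqF ?Me //= => h; apply/eqP/h => f _.
rewrite oppr_ge0; have [<-|cf] := eqVneq c f; first by rewrite uc normr0 mulr0.
by rewrite mulr_le0_ge0 // Mneg.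
Qed.

Lemma ground_exists (a0 : T) : exists l u,
  [/\ dotp u u = 1, forall a, 0 < u a, forall a, mulv M u a = l * u a &
      forall w, l * dotp w w <= dotp w (mulv M w)].
Proof.
pose A (i : void) : T -> R := of_void _ i.
have [||u [_ u1 umin]] := @rayleigh_min R T M void A (ptmass a0).
- by move=> [].
- by rewrite dotp_ptmass /ptmass eqxx oner_eq0.
have {}umin w : dotp u (mulv M u) * dotp w w <= dotp w (mulv M w).
  by apply: umin => -[].
have uu : dotp u (mulv M u) <= dotp u (mulv M u) * dotp u u by rewrite u1 mulr1.
exists (dotp u (mulv M u)), (fun a => `|u a|); split => //.
- by rewrite dotp_abs.
- move=> a; rewrite normr_gt0; apply/eqP => ua.
  have := u1; rewrite /dotp big1 => [/eqP|b _]; first by rewrite eq_sym oner_eq0.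
  by rewrite (ground_vanish umin uu ua) mul0r.
- exact: abs_ground.
Qed.

(** The difference of [u \o s] and [u] is again at the ground level and vanishes at the fixed point
    [x], hence everywhere. *)
Lemma ground_invariant (l : R) u (s : T -> T) x :
  (forall w, l * dotp w w <= dotp w (mulv M w)) ->
  (forall a, mulv M u a = l * u a) ->
  involutive s -> (forall a b, M (s a) (s b) = M a b) -> s x = x ->
  forall a, u (s a) = u a.
Proof.
move=> lmin ueig sK Ms sx a.
pose d a := u (s a) + (-1) * u a.
have us b : mulv M (fun a => u (s a)) b = l * u (s b).
  rewrite -ueig /mulv (reindex_inj (inv_inj sK)) /=.
  by apply: eq_bigr => c _; rewrite sK -(Ms (s b)) sK.
have deig b : mulv M d b = l * d b.
  by rewrite /d mulv_lin us ueig; ring.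
have d0 : d x = 0 by rewrite /d sx; ring.
have := @ground_vanish l d x lmin _ d0 a; rewrite /d => h.
apply/subr0_eq; rewrite -mulN1r; apply: h.
by rewrite (dotp_eigen deig).
Qed.

(** Odd functions are those orthogonal to every [ptmass (s a) + ptmass a], and [M] preserves them
    because it commutes with [s]; so a minimizer of the form among them is an eigenvector. *)
Lemma odd_exists (s : T -> T) p :
  involutive s -> (forall a b, M (s a) (s b) = M a b) ->
  (forall a, p (s a) = - p a) -> dotp p p != 0 ->
  exists l w, [/\ dotp w w = 1, forall a, w (s a) = - w a,
    forall a, mulv M w a = l * w a & l * dotp p p <= dotp p (mulv M p)].
Proof.
move=> sK Ms podd p0.
(* The factor 1 gives the shape [u + c * w] that [dotp_lin] expects. *)
pose A (a : T) : T -> R := fun c => ptmass (s a) c + 1 * ptmass a c.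
have AE a w : dotp (A a) w = w (s a) + w a.
  by rewrite dotpC dotp_lin !dotp_ptmass mul1r.
have Ap : orth A p by move=> a; rewrite AE podd addNr.
have [w [Aw w1 wmin]] := rayleigh_min M Ap p0.
exists (dotp w (mulv M w)), w; split => //.
- by move=> a; have := Aw a; rewrite AE => /eqP; rewrite addr_eq0 => /eqP.
- apply: (eigen_of_min Msym _ wmin Aw); last by rewrite w1 mulr1.
  move=> v Av a; rewrite AE /mulv (reindex_inj (inv_inj sK)) -big_split /=.
  rewrite big1 // => b _.
  by rewrite Ms -mulrDr -AE Av mulr0.
- exact: wmin.
Qed.

(** Otherwise [w] would minimize the form; being odd it vanishes at the fixed point [x], so it would
    vanish everywhere. *)
Lemma odd_above_ground (s : T -> T) (l l1 : R) w x :
  (forall w, l * dotp w w <= dotp w (mulv M w)) ->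
  dotp w w = 1 -> (forall a, w (s a) = - w a) ->
  (forall a, mulv M w a = l1 * w a) -> s x = x -> l < l1.
Proof.
move=> lmin w1 wodd weig sx; rewrite ltNge; apply/negP => l1l.
have wx : w x = 0 by have := wodd x; rewrite sx; lra.
have := w1; rewrite /dotp big1 => [/eqP|b _]; first by rewrite eq_sym oner_eq0.
rewrite (@ground_vanish l w x lmin _ wx) ?mul0r //.
by rewrite (dotp_eigen weig) w1 !mulr1.
Qed.

End GroundStates.

Lemma mpow_invariant {R : realType} {T : finType} (M : T -> T -> R) (s : T -> T) :
  involutive s -> (forall a b, M (s a) (s b) = M a b) ->
  forall n a b, mpow M n (s a) (s b) = mpow M n a b.
Proof.
move=> sK Ms; elim=> [|n IH] a b /=; first by rewrite (inj_eq (inv_inj sK)).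
rewrite (reindex_inj (inv_inj sK)) /=.
by apply: eq_bigr => c _; rewrite Ms IH.
Qed.

(** With degrees as neighbour sums of 1, the lemmas evaluating neighbour sums compute degrees as
    well. *)
Lemma degE (R : realType) (T : finType) (e : rel T) a :
  deg R e a = \sum_(b | e a b) 1.
Proof.
rewrite sumr_const; congr _%:R; apply: eq_card => b.
by apply/idP/idP => [/set_mem|/mem_set].
Qed.

(** * Triple wells with a symmetry exchanging [y] and [z] *)

Section TripleWell.
Context {R : realType} {T : finType}.
Variables (e : rel T) (x y z : T) (Wp : T -> R).
Hypotheses (esimple : simple_graph e) (econ : connected_graph e).
Hypotheses (xy : x != y) (yz : y != z) (xz : x != z) (eyz : e y z = false).
Hypothesis WpE : forall a, Wp a = [|| a == x, a == y | a == z]%:R.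
Implicit Types (w p : T -> R) (l Q : R).

Let esym : symmetric e := esimple.1.
Let eirr : irreflexive e := esimple.2.

Definition graph_involution (s : T -> T) : Prop :=
  involutive s /\ forall a b, e (s a) (s b) = e a b.

Lemma deg_ge1 a : 1 <= deg R e a.
Proof.
have [b ab] : exists b, a != b.
  by have [->|ax] := eqVneq a x; [exists y|exists x].
have /connectP[[|c s] /=] := econ a b; first by move=> _ ba; rewrite ba eqxx in ab.
move=> /andP[ac _] _; rewrite degE (bigD1 c) //= lerDl.
exact: sumr_ge0.
Qed.

Lemma sqrt_deg_ge1 a b : 1 <= Num.sqrt (deg R e a * deg R e b).
Proof.
rewrite -[leLHS]sqrtr1 ler_wsqrtr //.
by have := deg_ge1 a; have := deg_ge1 b; nra.
Qed.

Lemma Lap_sym a b : Lap R e a b = Lap R e b a.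
Proof. by rewrite /Lap eq_sym esym mulrC. Qed.

Lemma Lap_edge a b : e a b -> Lap R e a b < 0.
Proof.
move=> eab; rewrite /Lap; case: eqVneq => [ab|_]; first by rewrite ab eirr in eab.
by rewrite eab oppr_lt0 invr_gt0; apply: lt_le_trans (sqrt_deg_ge1 a b).
Qed.

Lemma Lap_offdiag a b : a != b -> -1 <= Lap R e a b <= 0.
Proof.
move=> ab; rewrite /Lap (negbTE ab); case: ifP => _; last by rewrite lerN10 lexx.
have h := sqrt_deg_ge1 a b; rewrite lerN2 oppr_le0 invr_ge0 sqrtr_ge0 andbT.
by rewrite invf_le1 //; apply: lt_le_trans h.
Qed.

Lemma Ham_sym Q a b : Ham e Wp Q a b = Ham e Wp Q b a.
Proof. by rewrite /Ham Lap_sym eq_sym; case: eqVneq => [->|]. Qed.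

Lemma Ham_offdiag Q a b : a != b -> Ham e Wp Q a b = Lap R e a b.
Proof. by move=> ab; rewrite /Ham (negbTE ab) subr0. Qed.

Lemma Ham_diag Q a : Ham e Wp Q a a = 1 - Q * Wp a.
Proof. by rewrite /Ham /Lap eqxx. Qed.

Lemma Ham_nonpos Q : offdiag_nonpos (Ham e Wp Q).
Proof. by move=> a b ab; rewrite Ham_offdiag //; case/andP: (Lap_offdiag ab). Qed.

Lemma Ham_edge Q a b : e a b -> Ham e Wp Q a b < 0.
Proof.
move=> eab; rewrite Ham_offdiag ?Lap_edge //; apply/eqP => ab.
by rewrite ab eirr in eab.
Qed.

Lemma deg_involution s a : graph_involution s -> deg R e (s a) = deg R e a.
Proof.
move=> [sK se]; rewrite !degE (reindex_inj (inv_inj sK)) /=.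
by apply: eq_bigl => b; rewrite se.
Qed.

Lemma Ham_involution s Q : graph_involution s -> (forall a, Wp (s a) = Wp a) ->
  forall a b, Ham e Wp Q (s a) (s b) = Ham e Wp Q a b.
Proof.
move=> sg sW a b; have [sK se] := sg.
by rewrite /Ham /Lap (inj_eq (inv_inj sK)) se !deg_involution // sW.
Qed.

(** Off the wells the eigenvalue equation reads [S = (l - 1) * w a] with [|S| <= #|T|] and
    [|l - 1| >= Q]. So each such vertex has mass at most [#|T|^2 / Q], and there are at most [#|T|]
    of them. *)
Lemma eigen_localized Q l w : 1 <= Q -> l <= 1 - Q -> dotp w w = 1 ->
  (forall a, mulv (Ham e Wp Q) w a = l * w a) ->
  1 - #|T|%:R ^+ 3 / Q <= w x ^+ 2 + w y ^+ 2 + w z ^+ 2.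
Proof.
move=> Q1 lQ w1 weig; set n := #|T|%:R : R.
have small a : ~~ [|| a == x, a == y | a == z] -> w a ^+ 2 <= n ^+ 2 / Q.
  move=> na; have := weig a; rewrite /mulv (bigD1 a) //= Ham_diag WpE (negbTE na).
  rewrite mulr0 subr0 mul1r; set S := \sum_(b | _) _ => wS.
  have Sn : `|S| <= n.
    apply: (le_trans (ler_norm_sum _ _ _)).
    have -> : n = \sum_(b : T) 1 by rewrite sumr_const.
    rewrite [leRHS](bigID (fun b => b != a)) /= -[leLHS]addr0.
    apply: lerD; last exact: sumr_ge0.
    apply: ler_sum => b; rewrite eq_sym => ab.
    rewrite Ham_offdiag // normrM -[leRHS]mulr1.
    apply: ler_pM => //.
      by case/andP: (Lap_offdiag ab) => h1 h2; rewrite ler_norml h1 (le_trans h2).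
    have := dotp_coord_le w b; rewrite w1 ler_norml => wb.
    by apply/andP; split; nra.
  have Sw : S = (l - 1) * w a by lra.
  have SQ : Q ^+ 2 * w a ^+ 2 <= n ^+ 2.
    apply: (@le_trans _ _ (S ^+ 2)); last first.
      by rewrite -[leLHS]real_normK ?num_real // ler_sqr ?nnegrE // ler0n.
    rewrite Sw exprMn ler_wpM2r ?sqr_ge0 // -[leRHS]sqrrN ler_sqr ?nnegrE; lra.
  rewrite ler_pdivlMr; last by lra.
  apply: le_trans SQ; rewrite mulrC ler_wpM2r ?sqr_ge0 // expr2.
  by nra.
have : dotp w w = 1 by [].
rewrite /dotp (bigD1 x) //= (bigD1 y) 1?eq_sym //= (bigD1 z) /=; last first.
  by rewrite eq_sym xz eq_sym yz.
rewrite -!expr2; set S := \sum_(b | _) _ => wS.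
suff : S <= n ^+ 3 / Q by lra.
have -> : n ^+ 3 / Q = \sum_(b : T) n ^+ 2 / Q.
  by rewrite sumr_const -[RHS]mulr_natl -/n; ring.
rewrite [leRHS](bigID (fun b => (b != x) && (b != y) && (b != z))) /= -[leLHS]addr0.
apply: lerD; last first.
  by apply: sumr_ge0 => b _; rewrite divr_ge0 ?sqr_ge0 //; lra.
apply: ler_sum => b /andP[/andP[bx hy] hz]; rewrite -expr2; apply: small.
by rewrite (negbTE bx) (negbTE hy) (negbTE hz).
Qed.

Definition ground_state Q l w : Prop :=
  [/\ dotp w w = 1, forall a, 0 < w a,
      forall a, mulv (Ham e Wp Q) w a = l * w a &
      forall p, l * dotp p p <= dotp p (mulv (Ham e Wp Q) p)].

Lemma qform_ptmass (U : T -> T -> R) a b :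
  dotp (ptmass a) (mulv U (ptmass b)) = U a b.
Proof. by rewrite dotpC dotp_ptmass; exact: dotp_ptmass. Qed.

Lemma well_energy Q a : Wp a = 1 -> Ham e Wp Q a a = 1 - Q.
Proof. by move=> Wa; rewrite Ham_diag Wa mulr1. Qed.

Variable s : T -> T.
Hypotheses (sg : graph_involution s) (sx : s x = x) (sy : s y = z).

Let sz : s z = y. Proof. by rewrite -sy sg.1. Qed.

Let sW a : Wp (s a) = Wp a.
Proof.
rewrite !WpE; congr (_ _); rewrite -{1}sx -{1}sy -{1}sz.
by rewrite !(inj_eq (inv_inj sg.1)) (orbC (a == y)).
Qed.

Let Wy : Wp y = 1. Proof. by rewrite WpE eqxx orbT. Qed.
Let Wz : Wp z = 1. Proof. by rewrite WpE eqxx !orbT. Qed.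

(** The vector [q] without its factor [1 / sqrt 2]; the two-level estimate divides by squared norms
    instead. *)
Let anti : T -> R := fun a => ptmass y a + (-1) * ptmass z a.

Let anti_norm : dotp anti anti = 2.
Proof.
rewrite dotp_lin_sqr !dotp_ptmass /ptmass !eqxx eq_sym (negbTE yz) /=; ring.
Qed.

(** Test functions bound the energies: [ptmass y] for the ground level, and [anti] for the odd one,
    whose form is exactly [2 * (1 - Q)] because [y] and [z] are not adjacent. *)
Lemma well_states Q : exists l0 w0 l1 w1, [/\ ground_state Q l0 w0,
  l0 <= 1 - Q /\ l1 <= 1 - Q, l0 < l1,
  dotp w1 w1 = 1 /\ (forall a, w1 (s a) = - w1 a) &
  forall a, mulv (Ham e Wp Q) w1 a = l1 * w1 a].
Proof.
have Hsym := Ham_sym Q; have Hneg := @Ham_nonpos Q; have He := @Ham_edge Q.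
have Hs := Ham_involution Q sg sW.
have [l0 [w0 [w01 w0pos w0eig l0min]]] := ground_exists Hsym Hneg He econ x.
have anti_odd a : anti (s a) = - anti a.
  have sE b c : (s b == c) = (b == s c) by rewrite -{1}(sg.1 c) (inj_eq (inv_inj sg.1)).
  by rewrite /anti /ptmass !sE sy sz; ring.
have anti0 : dotp anti anti != 0 by rewrite anti_norm pnatr_eq0.
have [l1 [w1 [w11 w1odd w1eig l1le]]] := odd_exists Hsym sg.1 Hs anti_odd anti0.
exists l0, w0, l1, w1; split => //.
- split.
    have := l0min (ptmass y); rewrite qform_ptmass dotp_ptmass /ptmass eqxx mulr1.
    by rewrite well_energy.
  move: l1le; rewrite anti_norm mulv_lin_form // !qform_ptmass !well_energy //.
  rewrite Ham_offdiag 1?eq_sym // /Lap eq_sym (negbTE yz) esym eyz; lra.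
- exact: (odd_above_ground Hsym Hneg He econ l0min w11 w1odd w1eig sx).
Qed.

(** An odd [w] vanishes at [x] and takes opposite values at [y] and [z], so its overlap with [anti]
    captures all of its mass on the wells. *)
Let anti_overlap Q l w : 1 <= Q -> l <= 1 - Q -> dotp w w = 1 ->
  (forall a, w (s a) = - w a) ->
  (forall a, mulv (Ham e Wp Q) w a = l * w a) ->
  (1 - #|T|%:R ^+ 3 / Q) * dotp anti anti <= dotp w anti ^+ 2.
Proof.
move=> Q1 lQ w1 wodd weig; have := eigen_localized Q1 lQ w1 weig.
have := wodd x; have := wodd y; rewrite sx sy => wz wx.
have {}wx : w x = 0 by lra.
by rewrite anti_norm dotp_lin !dotp_ptmass wz wx; lra.
Qed.

(** The part common to both graphs: [p] approximates the ground state, [anti] the odd state. The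
    identity for [kap] is asked of every symmetric kernel invariant under the symmetries, so that it
    serves real and imaginary parts of the propagator alike. *)
Lemma TC_two_level (p : T -> R) (kap K : R) : kap != 0 -> 0 < dotp p p -> 0 <= K ->
  (forall Q l w, 1 <= Q -> l <= 1 - Q -> ground_state Q l w ->
    (1 - K / Q) * dotp p p <= dotp w p ^+ 2) ->
  (forall Q (U : T -> T -> R), (forall a b, U a b = U b a) ->
    (forall t : T -> T, graph_involution t -> (forall a, Wp (t a) = Wp a) ->
       forall a b, U (t a) (t b) = U a b) ->
    kap * U z y = qform p U / dotp p p - (U y y + U z z - 2 * U z y) / 2) ->
  TC e Wp y z = (4 / kap ^+ 2)%:E.
Proof.
move=> kap0 p0 K0 ov UE; set n := #|T|%:R ^+ 3 : R.
have n0 : 0 <= n by rewrite exprn_ge0 // ler0n.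
have kap2 : 0 < kap ^+ 2 by rewrite exprn_even_gt0.
(* From this threshold on, [eps = (K + n) / Q] is at most 1/2; it dominates both overlap errors,
   [K / Q] and [n / Q]. *)
have main Q : 1 + 2 * (K + n) <= Q ->
    (forall t, kap ^+ 2 * prob e Wp Q t y z <= 4) /\
    (exists2 t, 0 <= t & (2 - 4 * ((K + n) / Q)) ^+ 2 <= kap ^+ 2 * prob e Wp Q t y z).
  move=> QK; have Q1 : 1 <= Q by lra.
  have Q0 : 0 < Q by lra.
  have [l0 [w0 [l1 [w1 [gs [l0Q l1Q] l01 [w11 w1odd] w1eig]]]]] := well_states Q.
  have [w01 _ w0eig _] := gs.
  have Hsym := Ham_sym Q.
  have KQ : K / Q <= (K + n) / Q by rewrite ler_pM2r ?invr_gt0 //; lra.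
  have nQ : n / Q <= (K + n) / Q by rewrite ler_pM2r ?invr_gt0 //; lra.
  apply: (two_level Hsym l01 w01 w0eig w11 w1eig p0 (p2 := anti)).
  - by rewrite anti_norm.
  - by rewrite ler_pdivrMr //; lra.
  - apply: le_trans (ov _ _ _ Q1 l0Q gs); rewrite ler_pM2r //; lra.
  - apply: le_trans (anti_overlap Q1 l1Q w11 w1odd w1eig).
    by rewrite anti_norm ler_pM2r // lerD2l lerN2.
  - move=> t; rewrite anti_norm {2}/qform mulv_lin_form; last first.
      by move=> *; exact: evol_reC.
    rewrite !qform_ptmass (UE Q (fun a b => evol_re (Ham e Wp Q) t b a)).
    + by ring.
    + by move=> *; exact: evol_reC.
    + move=> f [fK fe] fW a b; rewrite /evol_re; congr (limn (series _)).
      apply/funext => k; rewrite mpow_invariant //.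
      exact: Ham_involution.
  - move=> t; rewrite anti_norm {2}/qform mulv_lin_form; last first.
      by move=> *; exact: evol_imC.
    rewrite !qform_ptmass (UE Q (fun a b => evol_im (Ham e Wp Q) t b a)).
    + by ring.
    + by move=> *; exact: evol_imC.
    + move=> f [fK fe] fW a b; rewrite /evol_im; congr (limn (series _)).
      apply/funext => k; rewrite mpow_invariant //.
      exact: Ham_involution.
(* The 16 comes from [(2 - 4 * eps) ^+ 2 >= 4 - 16 * eps]. *)
apply: (@TC_eq R T e Wp y z _ (16 * (K + n) / kap ^+ 2) (1 + 2 * (K + n))) => Q QK.
  by move=> t; rewrite ler_pdivlMr // mulrC; apply: (main Q QK).1.
have [_ [t t0 h]] := main Q QK; exists t => //.
rewrite mulrAC -mulrBl ler_pdivrMr // mulrC [leRHS]mulrC.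
apply: le_trans h; have := sqr_ge0 ((K + n) / Q); lra.
Qed.

Lemma ground_state_invariant Q l w t a : graph_involution t ->
  (forall a, Wp (t a) = Wp a) -> t a = a -> ground_state Q l w ->
  forall b, w (t b) = w b.
Proof.
move=> tg tW ta [_ _ weig lmin].
apply: (ground_invariant (Ham_sym Q) (@Ham_nonpos Q) (@Ham_edge Q) econ
  lmin weig tg.1 _ ta).
exact: Ham_involution.
Qed.

(** The ground state takes equal values at [y] and [z], so its overlap with [chi_y + chi_z] misses
    only the localization error and the mass at [x], whence the constant [K + #|T|^3]. *)
Theorem TC_decoupled (K : R) : 0 <= K ->
  (forall Q l w, 1 <= Q -> l <= 1 - Q -> ground_state Q l w -> w x ^+ 2 <= K / Q) ->
  TC e Wp y z = 1%:E.
Proof.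
move=> K0 hx; pose p a : R := ptmass y a + 1 * ptmass z a.
have pp : dotp p p = 2.
  rewrite dotp_lin_sqr !dotp_ptmass /ptmass !eqxx eq_sym (negbTE yz) /=; ring.
have -> : 1 = 4 / 2 ^+ 2 :> R by field.
apply: (@TC_two_level p 2 (K + #|T|%:R ^+ 3)) => //.
- by rewrite pp.
- by rewrite addr_ge0 // exprn_ge0 // ler0n.
- move=> Q l w Q1 lQ gs; have wx := hx Q l w Q1 lQ gs.
  have [w1 _ weig _] := gs.
  have := eigen_localized Q1 lQ w1 weig.
  have := ground_state_invariant sg sW sx gs y; rewrite sy => wz.
  by rewrite pp dotp_lin !dotp_ptmass wz mulrDl; lra.
- move=> Q U Usym _; rewrite pp {1}/qform mulv_lin_form // !qform_ptmass.
  by field.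
Qed.

(** Under [s] and [t] the ground state is equal at the three wells, and the kernel has one diagonal
    value [d] and one off-diagonal value [o] there. The normalized forms are then [d + 2 o] and
    [d - o], with difference [3 o]. *)
Theorem TC_symmetric (t : T -> T) : graph_involution t -> t x = y -> t z = z ->
  TC e Wp y z = (4 / 9)%:E.
Proof.
move=> tg tx tz; pose p' a : R := ptmass y a + 1 * ptmass z a.
pose p a : R := p' a + 1 * ptmass x a.
have ty : t y = x by rewrite -tx tg.1.
have tW a : Wp (t a) = Wp a.
  rewrite !WpE; congr (_ _); rewrite -{1}tx -{1}ty -{1}tz.
  by rewrite !(inj_eq (inv_inj tg.1)) orbCA.
have pp : dotp p p = 3.
  rewrite dotp_lin_sqr dotp_ptmass dotp_lin_sqr !dotp_ptmass /p' /ptmass !eqxx.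
  rewrite (negbTE xy) (negbTE xz) eq_sym (negbTE yz) /=; ring.
have -> : 4 / 9 = 4 / 3 ^+ 2 :> R by field.
apply: (@TC_two_level p 3 (#|T|%:R ^+ 3)) => //.
- by rewrite pp.
- move=> Q l w Q1 lQ gs; have [w1 _ weig _] := gs.
  have := eigen_localized Q1 lQ w1 weig.
  have := ground_state_invariant sg sW sx gs y; rewrite sy => wz.
  have := ground_state_invariant tg tW tz gs x; rewrite tx => wy.
  by rewrite pp !dotp_lin !dotp_ptmass wz wy; lra.
- move=> Q U Usym Uinv; rewrite pp {1}/qform mulv_lin_form // mulv_lin_form //.
  have -> : dotp (ptmass x) (mulv U p') = U x y + 1 * U x z.
    by rewrite dotpC dotp_ptmass mulv_lin; congr (_ + _ * _); exact: dotp_ptmass.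
  rewrite !qform_ptmass.
  have := Uinv s sg sW y y; have := Uinv s sg sW x y.
  have := Uinv t tg tW x x; have := Uinv t tg tW x z.
  rewrite sx sy tx tz (Usym y z) => <- <- -> ->.
  by field.
Qed.
End TripleWell.

(** * The recurrences along two arms and their discrete Wronskian *)

Section ArmDecay.
Context {R : realType}.
(** [a] and [b] are the values of [f] on the arms of [x] and [y], from the triangle at 0 to the tip
    at [m.*2.+1]; [c] is its value at the added vertex and [mu] is [1 - l]. The well is at [m.+1],
    so the recurrence centred at [j.+1] sees it when [j == m]. The arm of [z] repeats [b]. *)
Variables (m : nat) (mu Q c : R) (a b : nat -> R).
Hypotheses (mu2 : 2 <= mu) (c0 : 0 < c).
Hypothesis a01 : forall j, (j <= m.*2.+1)%N -> 0 < a j <= 1.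
Hypothesis b01 : forall j, (j <= m.*2.+1)%N -> 0 < b j <= 1.
Hypothesis a_hub : 3 * mu * a 0%N = a 1%N + 2 * b 0%N.
Hypothesis b_hub : 3 * mu * b 0%N = b 1%N + a 0%N + b 0%N.
Hypothesis a_mid : forall j, (j < m.*2)%N ->
  2 * (mu - Q * (j == m)%:R) * a j.+1 = a j + a j.+2.
Hypothesis b_mid : forall j, (j < m.*2)%N ->
  2 * (mu - Q * (j == m)%:R) * b j.+1 = b j + b j.+2.
Hypothesis a_end : 2 * mu * a m.*2.+1 = a m.*2 + c.
Hypothesis c_end : mu * c = a m.*2.+1.
Hypothesis b_end : mu * b m.*2.+1 = b m.*2.

Let wr j := a j * b j.+1 - a j.+1 * b j.

(** The well enters both recurrences with the same coefficient, which cancels from the antisymmetric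
    expression. *)
Lemma wronskian_const j : (j <= m.*2)%N -> wr j = wr 0%N.
Proof.
elim: j => // j IH jm; rewrite -IH; last by lia.
have := a_mid jm; have := b_mid jm; rewrite /wr.
set q := 2 * _ => bE aE.
have -> : a j = q * a j.+1 - a j.+2 by rewrite aE; ring.
have -> : b j = q * b j.+1 - b j.+2 by rewrite bE; ring.
ring.
Qed.

(** The tip of the [x] arm has degree 2, that of the [y] arm degree 1. With tip values [a] and [b],
    the excess is [((mu - 1) * a - c) * b], and [mu * c = a] makes it nonnegative for [mu >= 2]. *)
Lemma wronskian_ge : a m.*2.+1 * b m.*2.+1 <= wr 0%N.
Proof.
have h2 := mu2; have hc := c0.
rewrite -(wronskian_const (leqnn _)) /wr -b_end.
have -> : a m.*2 = 2 * mu * a m.*2.+1 - c by rewrite a_end; ring.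
have /andP[aL _] := a01 (leqnn _); have /andP[bL _] := b01 (leqnn _).
rewrite -subr_ge0.
have -> : (2 * mu * a m.*2.+1 - c) * b m.*2.+1 -
   a m.*2.+1 * (mu * b m.*2.+1) - a m.*2.+1 * b m.*2.+1 =
   ((mu - 1) * a m.*2.+1 - c) * b m.*2.+1 by ring.
apply: mulr_ge0; last exact: ltW.
have -> : (mu - 1) * a m.*2.+1 - c = ((mu - 1) * mu - 1) * c.
  by rewrite -c_end; ring.
have : 0 <= (mu - 2) * (mu + 1) by apply: mulr_ge0; lra.
by move=> ?; apply: mulr_ge0; [lra|exact: ltW].
Qed.

Lemma wronskian_gt0 : 0 < wr 0%N.
Proof.
apply: lt_le_trans wronskian_ge.
by apply: mulr_gt0; [case/andP: (a01 (leqnn _))|case/andP: (b01 (leqnn _))].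
Qed.

(** At the triangle the Wronskian factors as [(b 0 - a 0) * (2 * b 0 + a 0)], so its positivity
    settles [j = 0]; further out it says that [a / b] decreases along the arm. *)
Lemma arm_le j : (j <= m.*2.+1)%N -> a j <= b j.
Proof.
elim: j => [_|j IH jm].
  have /andP[a0 _] := a01 (leq0n _); have /andP[b0 _] := b01 (leq0n _).
  have := wronskian_gt0; rewrite /wr.
  have -> : b 1%N = 3 * mu * b 0%N - a 0%N - b 0%N by rewrite b_hub; ring.
  have -> : a 1%N = 3 * mu * a 0%N - 2 * b 0%N by rewrite a_hub; ring.
  move=> h; have : 0 < (b 0%N - a 0%N) * (2 * b 0%N + a 0%N) by lra.
  by rewrite pmulr_lgt0; lra.
have /IH ab : (j <= m.*2.+1)%N by lia.
have : 0 < wr j by rewrite wronskian_const ?wronskian_gt0 //; lia.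
have /andP[aj _] := a01 (ltnW jm); have /andP[bj _] := b01 (ltnW jm).
have /andP[aj1 _] := a01 jm; have /andP[bj1 _] := b01 jm.
rewrite /wr subr_gt0 => h.
have : a j.+1 * b j <= b j.+1 * b j.
  by apply: (le_trans (ltW h)); rewrite mulrC ler_pM2l.
by rewrite ler_pM2r.
Qed.

(** Beyond the well, [2 * mu] times a value is the sum of its two positive neighbours, hence at
    least the inner one; the tips obey the same bound. *)
Lemma arm_tail k : (k <= m)%N ->
  a m.+1 <= (2 * mu) ^+ k * a (m.+1 + k)%N /\
  b m.+1 <= (2 * mu) ^+ k * b (m.+1 + k)%N.
Proof.
have h2 := mu2; have hc := c0.
elim: k => [_|k IH km]; first by rewrite expr0 addn0 !mul1r.
have mu0 : 0 <= 2 * mu by lra.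
have [ha hb] : a (m.+1 + k)%N <= 2 * mu * a (m.+1 + k).+1 /\
               b (m.+1 + k)%N <= 2 * mu * b (m.+1 + k).+1.
  have [kL|kL] : (m.+1 + k = m.*2)%N \/ (m.+1 + k < m.*2)%N by lia.
    rewrite kL a_end -b_end; split; first by lra.
    have /andP[bL _] := b01 (leqnn _).
    by have : 0 <= mu * b m.*2.+1 by [apply: mulr_ge0; lra]; lra.
  have := a_mid kL; have := b_mid kL.
  rewrite (_ : (m.+1 + k == m)%N = false) ?mulr0 ?subr0; last by apply/eqP; lia.
  have /andP[a2 _] : 0 < a (m.+1 + k).+2 <= 1 by apply: a01; lia.
  have /andP[b2 _] : 0 < b (m.+1 + k).+2 <= 1 by apply: b01; lia.
  by move=> -> ->; lra.
have [IHa IHb] := IH (ltnW km); rewrite addnS exprSr -!(mulrA (_ ^+ k)).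
split; [apply: (le_trans IHa)|apply: (le_trans IHb)];
  by rewrite ler_wpM2l // exprn_ge0.
Qed.

(** Each value is the average of its neighbours divided by [mu], and these are at worst one step
    closer to the well; hence one factor [mu] per unit of distance. *)
Lemma arm_inner k j : (j + k <= m.+1)%N -> (0 < m)%N ->
  mu ^+ k * a j <= 1 /\ mu ^+ k * b j <= 1.
Proof.
have h2 := mu2; have hc := c0.
move=> + m0; elim: k j => [|k IH] j jk.
  rewrite expr0 !mul1r; split.
    by have /andP[] : 0 < a j <= 1 by apply: a01; lia.
  by have /andP[] : 0 < b j <= 1 by apply: b01; lia.
case: j jk => [|j] jk.
  have [a0 b0] := IH 0%N (ltac:(lia)); have [a1 b1] := IH 1%N (ltac:(lia)).
  split.
    have -> : mu ^+ k.+1 * a 0%N = mu ^+ k * (3 * mu * a 0%N) / 3.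
      by rewrite exprS; field.
    by rewrite a_hub; lra.
  have -> : mu ^+ k.+1 * b 0%N = mu ^+ k * (3 * mu * b 0%N) / 3.
    by rewrite exprS; field.
  by rewrite b_hub; lra.
have [a0 b0] := IH j (ltac:(lia)); have [a1 b1] := IH j.+2 (ltac:(lia)).
have jm : (j < m.*2)%N by lia.
have := a_mid jm; have := b_mid jm.
rewrite (_ : (j == m)%N = false) ?mulr0 ?subr0; last by apply/eqP; lia.
move=> hb ha; split.
  have -> : mu ^+ k.+1 * a j.+1 = mu ^+ k * (2 * mu * a j.+1) / 2.
    by rewrite exprS; field.
  by rewrite ha; lra.
have -> : mu ^+ k.+1 * b j.+1 = mu ^+ k * (2 * mu * b j.+1) / 2.
  by rewrite exprS; field.
by rewrite hb; lra.
Qed.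

(** Counting powers of [mu]: the tail costs [mu ^+ m] on each arm, whereas [a 0] and [b 1], at
    distances [m.+1] and [m] from the wells, supply [mu ^- m.+1] and [mu ^- m]. One factor [mu] is
    left over. *)
Lemma arm_decay : (0 < m)%N -> a m.+1 ^+ 2 <= 4 ^+ m / mu.
Proof.
have h2 := mu2; have hc := c0.
move=> m0.
have /andP[an _] : 0 < a m.+1 <= 1 by apply: a01; lia.
have an_bn : a m.+1 <= b m.+1 by apply: arm_le; lia.
have [ta tb] := arm_tail (leqnn m).
have mE : (m.+1 + m = m.*2.+1)%N by lia.
rewrite mE in ta tb.
have [ia _] := @arm_inner m.+1 0%N (ltac:(lia)) m0.
have [_ ib] := @arm_inner m 1%N (ltac:(lia)) m0.
have /andP[a0 _] := a01 (leq0n _).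
have /andP[b1 _] : 0 < b 1%N <= 1 by apply: b01.
have /andP[a1 _] : 0 < a 1%N <= 1 by apply: a01.
have /andP[b0 _] := b01 (leq0n _).
rewrite ler_pdivlMr; last by lra.
have mu0 : 0 <= mu by lra.
have w0 : wr 0%N <= a 0%N * b 1%N.
  by rewrite /wr gerBl mulr_ge0 // ltW.
have h1 : a m.+1 ^+ 2 <= (2 * mu) ^+ m * (2 * mu) ^+ m * (a 0%N * b 1%N).
  apply: (@le_trans _ _ (a m.+1 * b m.+1)).
    by rewrite expr2 ler_wpM2l // ltW.
  apply: (@le_trans _ _ ((2 * mu) ^+ m * a m.*2.+1 * ((2 * mu) ^+ m * b m.*2.+1))).
    by apply: ler_pM => //; [exact: ltW|exact/ltW/(lt_le_trans an)].
  rewrite mulrACA ler_wpM2l //; first by rewrite mulr_ge0 // exprn_ge0; lra.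
  exact: le_trans wronskian_ge w0.
apply: (@le_trans _ _ ((2 * mu) ^+ m * (2 * mu) ^+ m * (a 0%N * b 1%N) * mu)).
  by rewrite ler_wpM2r.
have -> : (2 * mu) ^+ m * (2 * mu) ^+ m * (a 0%N * b 1%N) * mu =
  4 ^+ m * ((mu ^+ m.+1 * a 0%N) * (mu ^+ m * b 1%N)).
  rewrite !exprMn exprS (_ : 4 = 2 * 2 :> R); last by ring.
  by rewrite exprMn; ring.
rewrite -[leRHS]mulr1 ler_wpM2l ?exprn_ge0 //.
rewrite -[leRHS]mulr1; apply: ler_pM => //.
  by rewrite mulr_ge0 ?exprn_ge0 // ltW.
by rewrite mulr_ge0 ?exprn_ge0 // ltW.
Qed.
End ArmDecay.

(** * Attaching a pendant vertex *)

Section Attach.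
Context {T : finType}.
Variables (e : rel T) (v0 : T).

Lemma attach_simple : simple_graph e -> simple_graph (attach e v0).
Proof.
by move=> [esym eirr]; split=> [[a|] [b|]|[a|]] /=.
Qed.

Lemma attach_connected : simple_graph e -> connected_graph e ->
  connected_graph (attach e v0).
Proof.
move=> es econ.
have csym := sym_connect_sym (attach_simple es).1.
have some a b : connect (attach e v0) (Some a) (Some b).
  apply: (connect_invariant
    (P := fun b => connect (attach e v0) (Some a) (Some b)) _ (econ a b)).
    by move=> c d ecd ac; apply: (connect_trans ac); exact: connect1.
  exact: connect0.
have none a : connect (attach e v0) None (Some a).
  by apply: connect_trans (some v0 a); apply: connect1 => /=.
by move=> [a|] [b|] //; rewrite csym.
Qed.

Lemma attach_involution s : graph_involution e s -> s v0 = v0 ->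
  graph_involution (attach e v0) (omap s).
Proof.
move=> [sK se] sv; split=> [[a|]|[a|] [b|]] //=; first by rewrite sK.
- by rewrite -{1}sv (inj_eq (inv_inj sK)).
- by rewrite -{1}sv (inj_eq (inv_inj sK)).
Qed.

Lemma sum_attach_some (R : realType) a (F : option T -> R) :
  \sum_(b | attach e v0 (Some a) b) F b =
  \sum_(b | e a b) F (Some b) + (if a == v0 then F None else 0).
Proof.
rewrite big_mkcond (bigD1 None) //= addrC; congr (_ + _).
rewrite (reindex_onto Some (odflt v0)) /=; last by case.
by rewrite [RHS]big_mkcond; apply: eq_big => // b; rewrite eqxx.
Qed.

Lemma sum_attach_none (R : realType) (F : option T -> R) :
  \sum_(b | attach e v0 None b) F b = F (Some v0).
Proof.
rewrite (bigD1 (Some v0)) /= ?eqxx // big1 ?addr0 // => -[b|] //=.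
by case/andP => /eqP-> /eqP.
Qed.

Lemma gballS r (S : {set T}) w : (w \in gball e r.+1 S) =
  (w \in gball e r S) || [exists u in gball e r S, e u w].
Proof. by rewrite /= finset.in_setU inE. Qed.

End Attach.

(** The new vertex has [v0] as its only neighbour, so it is not reached within [r] steps while [v0]
    is outside all balls of smaller radius. *)
Lemma gball_attach (T : finType) (e : rel T) v0 r (S : {set T}) :
  (forall k, (k < r)%N -> v0 \notin gball e k S) ->
  gball (attach e v0) r (Some @: S) = (Some @: gball e r S)%SET.
Proof.
elim: r => [//|r IH] far; have {}IH := IH (fun k kr => far k (ltnW kr)).
apply/setP => -[w|].
  rewrite gballS IH !(mem_imset _ _ Some_inj) gballS; congr (_ || _).
  apply/existsP/existsP => -[].
    move=> [u|] /andP[].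
      by rewrite (mem_imset _ _ Some_inj) => uB euw; exists u; rewrite uB.
    by move=> /imsetP[].
  by move=> u /andP[uB euw]; exists (Some u); rewrite (mem_imset _ _ Some_inj) uB.
rewrite gballS IH.
have noneN (A : {set T}) : (None \in (Some @: A)%SET) = false by apply/imsetP => -[].
rewrite !noneN /=; apply/existsP => -[[u|] /andP[]] //.
rewrite (mem_imset _ _ Some_inj) => uB /= /eqP uv.
by move: (far r (ltnSn r)); rewrite -uv uB.
Qed.

(** Dividing by [sqrt deg] turns the symmetrized Laplacian into unweighted neighbour sums, which
    gives the recurrences along the arms. *)
Lemma scaled_eigen (R : realType) (T : finType) (e : rel T) (Wp : T -> R)
    (Q l : R) (w : T -> R) :
  irreflexive e -> (forall a, 1 <= deg R e a) ->
  (forall a, mulv (Ham e Wp Q) w a = l * w a) ->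
  let f a := w a / Num.sqrt (deg R e a) in
  forall a, deg R e a * (1 - l - Q * Wp a) * f a = \sum_(b | e a b) f b.
Proof.
move=> eirr deg1 weig f a.
have d0 b : 0 < Num.sqrt (deg R e b).
  by rewrite sqrtr_gt0; apply: lt_le_trans (deg1 b).
have := weig a; rewrite /mulv (bigD1 a) //= {1}/Ham {1}/Lap eqxx.
have -> : \sum_(b | b != a) Ham e Wp Q a b * w b =
  - ((Num.sqrt (deg R e a))^-1 * \sum_(b | e a b) f b).
  rewrite mulr_sumr -sumrN [RHS]big_mkcond [LHS]big_mkcond /=.
  apply: eq_bigr => b _; have [->|ba] := eqVneq b a; first by rewrite eirr.
  rewrite /Ham /Lap eq_sym (negbTE ba) subr0; case: ifP => _; last by rewrite mul0r.
  rewrite sqrtrM ?invfM /f; last by apply: le_trans (deg1 a).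
  by rewrite mulNr; congr (- _); ring.
set S := \sum_(b | _) _ => h.
have -> : S = Num.sqrt (deg R e a) * ((Num.sqrt (deg R e a))^-1 * S).
  by rewrite mulrA divff ?mul1r // gt_eqF.
have -> : (Num.sqrt (deg R e a))^-1 * S = (1 - l - Q * Wp a) * w a by lra.
have {1}-> : deg R e a = Num.sqrt (deg R e a) ^+ 2.
  by rewrite sqr_sqrtr //; apply: le_trans (deg1 a).
by rewrite /f; field; rewrite gt_eqF.
Qed.

Lemma indic3E (R : realType) (T : eqType) (x y z a : T) :
  indic (R := R) [set x; y; z] a = [|| a == x, a == y | a == z]%:R.
Proof.
rewrite indicE; congr (_ _)%:R; apply/idP/idP.
  by move=> /set_mem[[->|->]|->]; rewrite eqxx ?orbT.
by move=> h; apply/mem_set; case/or3P: h => /eqP->; [left; left|left; right|right].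
Qed.

(** * The triangle with three arms *)

Section Spider.
Variable m : nat.

(** Arm [i], position [j]; the last clause is the triangle. Working on natural numbers reduces
    adjacency to linear arithmetic. *)
Definition spider_adj (i j i' j' : nat) : bool :=
  ((i == i') && ((j.+1 == j') || (j'.+1 == j))) ||
  [&& i != i', j == 0%N & j' == 0%N].

Notation spiderT := ('I_3 * 'I_m.*2.+2)%type.

Definition spider : rel spiderT := fun u v => spider_adj u.1 u.2 v.1 v.2.

Definition node (i j : nat) : spiderT := (inord i, inord j).

Lemma node_eq (c : spiderT) i j : (i < 3)%N -> (j < m.*2.+2)%N ->
  (c == node i j) = (c.1 == i :> nat) && (c.2 == j :> nat).
Proof.
by move=> i3 jN; rewrite -pair_eqE /pair_eq /= -!val_eqE /= !inordK.
Qed.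

Lemma node_val (c : spiderT) : node c.1 c.2 = c.
Proof. by case: c => i j; rewrite /node !inord_val. Qed.

Lemma spider_node i j i' j' : (i < 3)%N -> (j < m.*2.+2)%N ->
  (i' < 3)%N -> (j' < m.*2.+2)%N ->
  spider (node i j) (node i' j') = spider_adj i j i' j'.
Proof. by move=> *; rewrite /spider /= !inordK. Qed.

Lemma spider_simple : simple_graph spider.
Proof.
by split=> [a b|a]; rewrite /spider /spider_adj; lia.
Qed.

Lemma spider_connected : connected_graph spider.
Proof.
have csym := sym_connect_sym spider_simple.1.
have foot i j : (i < 3)%N -> (j < m.*2.+2)%N -> connect spider (node i 0) (node i j).
  move=> i3; elim: j => [_|j IH jN]; first exact: connect0.
  apply: (connect_trans (IH (ltnW jN))); apply: connect1.
  by rewrite spider_node ?(ltnW jN) // /spider_adj; lia.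
have hub i : (i < 3)%N -> connect spider (node 0 0) (node i 0).
  case: i => [_|i i3]; first exact: connect0.
  by apply: connect1; rewrite spider_node.
have all c : connect spider (node 0 0) c.
  rewrite -(node_val c); apply: connect_trans (hub _ (ltn_ord _)) _.
  exact: foot.
by move=> a b; apply: connect_trans (all b); rewrite csym.
Qed.

Definition swap_arms (i i' : nat) (c : spiderT) : spiderT :=
  (tperm (inord i) (inord i') c.1, c.2).

Lemma swap_arms_involution i i' : graph_involution spider (swap_arms i i').
Proof.
split=> [[c1 c2]|a b]; first by rewrite /swap_arms /= tpermK.
by rewrite /spider /spider_adj /= !val_eqE (inj_eq perm_inj).
Qed.

Lemma swap_armsL i i' j : swap_arms i i' (node i j) = node i' j.
Proof. by rewrite /swap_arms /= tpermL. Qed.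

Lemma swap_arms_other i i' k j : (i < 3)%N -> (i' < 3)%N -> (k < 3)%N ->
  i != k -> i' != k -> swap_arms i i' (node k j) = node k j.
Proof.
move=> i3 i'3 k3 ik i'k; rewrite /swap_arms /= tpermD //.
  by rewrite -val_eqE /= !inordK.
by rewrite -val_eqE /= !inordK.
Qed.

Context {R : realType}.
Implicit Type F : spiderT -> R.

Lemma sum_spider_mid i j F : (i < 3)%N -> (j < m.*2)%N ->
  \sum_(c | spider (node i j.+1) c) F c = F (node i j) + F (node i j.+2).
Proof.
move=> i3 jm; have j1 : (j.+1 < m.*2.+2)%N by lia.
have j0 : (j < m.*2.+2)%N by lia.
have j2 : (j.+2 < m.*2.+2)%N by lia.
rewrite (bigD1 (node i j)) /=; last by rewrite spider_node // /spider_adj; lia.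
rewrite (bigD1 (node i j.+2)) /=; last first.
  by rewrite spider_node // node_eq // /= !inordK // /spider_adj; lia.
rewrite big_pred0 ?addr0 // => c; rewrite !node_eq // /spider /= !inordK //.
by rewrite /spider_adj; move: (nat_of_ord c.1) (nat_of_ord c.2) => c1 c2; lia.
Qed.

Lemma sum_spider_hub i i' i'' F : (i < 3)%N -> (i' < 3)%N -> (i'' < 3)%N ->
  i != i' -> i != i'' -> i' != i'' ->
  \sum_(c | spider (node i 0) c) F c =
  F (node i 1) + F (node i' 0) + F (node i'' 0).
Proof.
move=> i3 i'3 i''3 ii' ii'' i'i''.
rewrite (bigD1 (node i 1)) /=; last by rewrite spider_node // /spider_adj; lia.
rewrite (bigD1 (node i' 0)) /=; last first.
  by rewrite spider_node // node_eq // /= !inordK // /spider_adj; lia.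
rewrite (bigD1 (node i'' 0)) /=; last first.
  by rewrite spider_node // !node_eq // /= !inordK // /spider_adj; lia.
rewrite big_pred0 ?addr0 ?addrA // => c; rewrite !node_eq // /spider /= !inordK //.
move: (ltn_ord c.1); rewrite /spider_adj.
by move: (nat_of_ord c.1) (nat_of_ord c.2) => c1 c2 c3; lia.
Qed.

Lemma sum_spider_end i F : (i < 3)%N ->
  \sum_(c | spider (node i m.*2.+1) c) F c = F (node i m.*2).
Proof.
move=> i3.
rewrite (bigD1 (node i m.*2)) /=; last by rewrite spider_node // /spider_adj; lia.
rewrite big_pred0 ?addr0 // => c; rewrite !node_eq // /spider /= !inordK //.
move: (ltn_ord c.2); rewrite /spider_adj.
by move: (nat_of_ord c.1) (nat_of_ord c.2) => c1 c2 c3; lia.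
Qed.

(** An edge changes the position along an arm by at most one; this keeps the tips outside small
    balls around the wells. *)
Lemma gball_spider_height k (S : {set spiderT}) :
  (forall c, c \in S -> (c.2 <= m.+1)%N) ->
  forall c, c \in gball spider k S -> (c.2 <= m.+1 + k)%N.
Proof.
move=> hS; elim: k => [|k IH] c; first by rewrite addn0; exact: hS.
rewrite gballS => /orP[/IH|/existsP[u /andP[/IH hu]]]; first by lia.
rewrite /spider /spider_adj; move: hu.
move: (nat_of_ord u.1) (nat_of_ord c.1) (nat_of_ord u.2) (nat_of_ord c.2).
by move=> u1 c1 u2 c2; lia.
Qed.
End Spider.

(** * Decay of the ground state at the well of the lengthened arm *)

Section LongArm.
Context {R : realType}.
Variables (m : nat) (Wp : option ('I_3 * 'I_m.*2.+2) -> R).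
Hypothesis m_gt0 : (0 < m)%N.

Notation well i := (node m i m.+1).
Notation leaf := (node m 0 m.*2.+1).
Notation longarm := (attach (spider (m := m)) leaf).

Hypothesis WpE : forall a,
  Wp a = [|| a == Some (well 0), a == Some (well 1) | a == Some (well 2)]%:R.

Lemma well_neq i i' : (i < 3)%N -> (i' < 3)%N -> i != i' -> well i != well i'.
Proof.
move=> i3 i'3 ii'; have mN : (m.+1 < m.*2.+2)%N by lia.
by rewrite node_eq // /= !inordK // (negbTE ii').
Qed.

Lemma Wp_node i j : (i < 3)%N -> (j < m.*2.+2)%N ->
  Wp (Some (node m i j)) = (j == m.+1)%:R.
Proof.
move=> i3 jN; have mN : (m.+1 < m.*2.+2)%N by lia.
have someE (c d : 'I_3 * 'I_m.*2.+2) : (Some c == Some d) = (c == d) by [].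
rewrite WpE !someE !node_eq // /= !inordK //; congr _%:R; congr nat_of_bool.
by lia.
Qed.

Lemma sum_inner i j (F : option ('I_3 * 'I_m.*2.+2) -> R) :
  (i < 3)%N -> (j < m.*2.+2)%N -> (i != 0%N) || (j != m.*2.+1) ->
  \sum_(b | longarm (Some (node m i j)) b) F b =
  \sum_(c | spider (node m i j) c) F (Some c).
Proof.
move=> i3 jN ij; rewrite sum_attach_some node_eq // /= !inordK //.
by rewrite -[_ && _]negbK negb_and ij addr0.
Qed.

Lemma sum_leaf (F : option ('I_3 * 'I_m.*2.+2) -> R) :
  \sum_(b | longarm (Some leaf) b) F b = F (Some (node m 0 m.*2)) + F None.
Proof. by rewrite sum_attach_some eqxx sum_spider_end. Qed.

(** Invariance under the swap of arms 1 and 2 leaves two arms to compare, and the arm estimate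
    applies to [f = w / sqrt deg] with [mu = 1 - l >= Q]. *)
Lemma longarm_decoupled Q l w : 1 <= Q -> l <= 1 - Q ->
  ground_state longarm Wp Q l w ->
  w (Some (well 0)) ^+ 2 <= (2 + 2 * 4 ^+ m) / Q.
Proof.
move=> Q1 lQ gs; have [w1 wpos weig _] := gs.
have w_le1 b : w b <= 1.
  by have := dotp_coord_le w b; rewrite w1; have := wpos b; nra.
have Q0 : 0 < Q by lra.
have p4 : 0 < 4 ^+ m :> R by rewrite exprn_gt0.
(* The arm estimate needs [1 - l >= 2]. For [Q < 2] the claim is trivial since
   [w ^+ 2 <= 1 < 2 / Q], which is what the summand 2 is for. *)
have [Q2|Q2] := ltP Q 2.
  rewrite ler_pdivlMr //; have := wpos (Some (well 0)); have := w_le1 (Some (well 0)).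
  move: (w _) => v v1 v0; nra.
have gsimple := attach_simple leaf (spider_simple m).
have gcon := attach_connected leaf (spider_simple m) (@spider_connected m).
have xy : Some (well 0) != Some (well 1) by rewrite (inj_eq Some_inj) well_neq.
have d1 a : 1 <= deg R longarm a by exact: (deg_ge1 gcon xy).
have s_inv := attach_involution (swap_arms_involution m 1 2)
  (@swap_arms_other m 1 2 0 m.*2.+1 isT isT isT isT isT).
have sW a : Wp (omap (swap_arms 1 2) a) = Wp a.
  have sE b c : (omap (swap_arms 1 2) b == c) = (b == omap (swap_arms (m := m) 1 2) c).
    by rewrite -{1}(s_inv.1 c) (inj_eq (inv_inj s_inv.1)).
  rewrite !WpE !sE /= swap_armsL swap_arms_other // /swap_arms /= tpermR.
  by rewrite (orbC (a == Some (well 2))).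
have w_sym a : w (omap (swap_arms 1 2) a) = w a.
  apply: (ground_state_invariant gsimple gcon xy s_inv sW (a := Some leaf) _ gs).
  by rewrite /= swap_arms_other.
have mu2 : 2 <= 1 - l by lra.
have [f [wf f01 f_sym E]] : exists f : option ('I_3 * 'I_m.*2.+2) -> R,
    [/\ forall a, w a ^+ 2 = deg R longarm a * f a ^+ 2,
        forall a, 0 < f a <= 1,
        forall j, f (Some (node m 2 j)) = f (Some (node m 1 j)) &
        forall a, deg R longarm a * (1 - l - Q * Wp a) * f a =
                  \sum_(b | longarm a b) f b].
  exists (fun a => w a / Num.sqrt (deg R longarm a)); split => [a|a|j|a].
  - have d0 : 0 < deg R longarm a by apply: lt_le_trans (d1 a).
    by rewrite expr_div_n sqr_sqrtr ?(ltW d0) // mulrCA divff ?mulr1 // gt_eqF.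
  - have s1 : 1 <= Num.sqrt (deg R longarm a) by rewrite -[leLHS]sqrtr1 ler_wsqrtr.
    have s0 : 0 < Num.sqrt (deg R longarm a) by apply: lt_le_trans s1.
    rewrite divr_gt0 //= ler_pdivrMr // mul1r; apply: le_trans s1; exact: w_le1.
  - have -> : Some (node m 2 j) = omap (swap_arms 1 2) (Some (node m 1 j)).
      by rewrite /= swap_armsL.
    by rewrite w_sym (deg_involution _ s_inv).
  - exact: (scaled_eigen gsimple.2 d1 weig).
have Enode i j : (i < 3)%N -> (j < m.*2.+2)%N -> deg R longarm (Some (node m i j)) *
    (1 - l - Q * (j == m.+1)%:R) * f (Some (node m i j)) =
    \sum_(b | longarm (Some (node m i j)) b) f b.
  by move=> i3 jN; rewrite -E Wp_node.
have Lm : (m.*2.+1 == m.+1) = false by lia.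
have hub i i' i'' : (i < 3)%N -> (i' < 3)%N -> (i'' < 3)%N ->
    i != i' -> i != i'' -> i' != i'' ->
    3 * (1 - l) * f (Some (node m i 0)) = f (Some (node m i 1)) +
      f (Some (node m i' 0)) + f (Some (node m i'' 0)).
  move=> i3 i'3 i''3 n1 n2 n3; have := Enode i 0%N i3 isT.
  have -> : deg R longarm (Some (node m i 0)) = 3.
    by rewrite degE sum_inner ?orbT // (sum_spider_hub _ i3 i'3 i''3) //; ring.
  by rewrite sum_inner ?orbT // (sum_spider_hub _ i3 i'3 i''3) //= mulr0 subr0.
have deg_mid i j : (i < 3)%N -> (j < m.*2)%N ->
    deg R longarm (Some (node m i j.+1)) = 2.
  move=> i3 jm; have jN : (j.+1 < m.*2.+2)%N by lia.
  by rewrite degE sum_inner ?sum_spider_mid //; lia.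
have mid i j : (i < 3)%N -> (j < m.*2)%N ->
    2 * (1 - l - Q * (j == m)%:R) * f (Some (node m i j.+1)) =
    f (Some (node m i j)) + f (Some (node m i j.+2)).
  move=> i3 jm; have jN : (j.+1 < m.*2.+2)%N by lia.
  have := Enode i j.+1 i3 jN.
  by rewrite deg_mid // sum_inner ?sum_spider_mid //; lia.
have endx : 2 * (1 - l) * f (Some leaf) = f (Some (node m 0 m.*2)) + f None.
  have := Enode 0%N m.*2.+1 isT (ltnSn _).
  have -> : deg R longarm (Some leaf) = 2.
    by rewrite degE sum_leaf.
  by rewrite sum_leaf Lm mulr0 subr0.
have endy : (1 - l) * f (Some (node m 1 m.*2.+1)) = f (Some (node m 1 m.*2)).
  have := Enode 1%N m.*2.+1 isT (ltnSn _).
  have -> : deg R longarm (Some (node m 1 m.*2.+1)) = 1.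
    by rewrite degE sum_inner // sum_spider_end.
  by rewrite sum_inner // sum_spider_end // Lm mulr0 subr0 mul1r.
have endc : (1 - l) * f None = f (Some leaf).
  have := E None; rewrite sum_attach_none WpE /=.
  have -> : deg R longarm None = 1 by rewrite degE sum_attach_none.
  by rewrite mulr0 subr0 mul1r.
have fc : 0 < f None by case/andP: (f01 None).
have := @arm_decay R m (1 - l) Q (f None) (fun j => f (Some (node m 0 j)))
  (fun j => f (Some (node m 1 j))) mu2 fc (fun j _ => f01 _) (fun j _ => f01 _).
move=> /(_ _ _ (fun j => mid 0%N j isT) (fun j => mid 1%N j isT) endx endc endy m_gt0).
rewrite (hub 0%N 1%N 2%N) // (hub 1%N 0%N 2%N) // !f_sym => h.
have {}h : f (Some (well 0)) ^+ 2 <= 4 ^+ m / (1 - l) by apply: h; [ring|].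
have degx : deg R longarm (Some (well 0)) = 2.
  by apply: deg_mid => //; rewrite -addnn -{1}(addn0 m) ltn_add2l.
(* The factor 2 is the degree of the well, and [1 - l >= Q] replaces the denominator. *)
rewrite wf degx; apply: (@le_trans _ _ (2 * (4 ^+ m / (1 - l)))).
  by rewrite ler_pM2l.
rewrite mulrA; apply: (@le_trans _ _ (2 * 4 ^+ m / Q)).
  rewrite ler_pM2l ?mulr_gt0 // lef_pV2 ?posrE; lra.
rewrite ler_pM2r ?invr_gt0 //; lra.
Qed.

End LongArm.

(** * The pair of graphs for a given radius *)

Theorem theorem4 (R : realType) (r : nat) (hr : (1 <= r)%N) :
  exists (T : finType) (e : rel T) (v0 x y z : T),
    [/\ simple_graph e /\ connected_graph e,
        [&& x != y, y != z & x != z],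
        gball (attach e v0) r [set Some x; Some y; Some z]
          = Some @: gball e r [set x; y; z],
        TC e (indic (R:=R) [set x; y; z]) y z = (4 / 9 : R)%:E
      & TC (attach e v0) (indic (R:=R) [set Some x; Some y; Some z]) (Some y) (Some z) = (1 : R)%:E].
Proof.
pose well i := node r i r.+1.
have gsim := spider_simple r; have gcon := @spider_connected r.
have xy : well 0%N != well 1%N by exact: well_neq.
have yz : well 1%N != well 2%N by exact: well_neq.
have xz : well 0%N != well 2%N by exact: well_neq.
have rN : (r.+1 < r.*2.+2)%N by lia.
have eyz : spider (well 1%N) (well 2%N) = false by rewrite spider_node.
have s12x : swap_arms 1 2 (well 0%N) = well 0%N by exact: swap_arms_other.
have s12y : swap_arms 1 2 (well 1%N) = well 2%N by exact: swap_armsL.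
(* The new vertex goes to the tip of the arm of [x], at distance [r] from the well. *)
exists ('I_3 * 'I_r.*2.+2)%type, (@spider r), (node r 0 r.*2.+1).
exists (well 0%N), (well 1%N), (well 2%N); split=> //.
- by rewrite xy yz.
- have -> : [set Some (well 0%N); Some (well 1%N); Some (well 2%N)]%SET =
            (Some @: [set well 0%N; well 1%N; well 2%N])%SET.
    by rewrite !imsetU !imset_set1.
  apply: gball_attach => k kr; apply/negP => /gball_spider_height h.
  (* For [k < r] the tip position [r.*2.+1] exceeds [r.+1 + k]. *)
  have : ((node r 0 r.*2.+1).2 <= r.+1 + k)%N.
    apply: h => c; rewrite !inE => /orP[/orP[]|] /eqP ->; by rewrite /= inordK.
  by rewrite /= inordK //; lia.
- apply: (TC_symmetric gsim gcon xy yz xz eyz (indic3E _ _ _ _)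
    (swap_arms_involution r 1 2) s12x s12y (swap_arms_involution r 0 1)).
    exact: swap_armsL.
  exact: swap_arms_other.
- have v0_fix : swap_arms 1 2 (node r 0 r.*2.+1) = node r 0 r.*2.+1.
    exact: swap_arms_other.
  have gsim' := attach_simple (node r 0 r.*2.+1) gsim.
  have gcon' := attach_connected (node r 0 r.*2.+1) gsim gcon.
  have s_inv := attach_involution (swap_arms_involution r 1 2) v0_fix.
  apply: (@TC_decoupled R _ (attach _ _) (Some (well 0%N)) (Some (well 1%N))
    (Some (well 2%N)) _ gsim' gcon' xy yz xz eyz _ _ s_inv _ _ (2 + 2 * 4 ^+ r)).
  + by move=> a; exact: indic3E.
  + by rewrite /= s12x.
  + by rewrite /= s12y.
  + by rewrite addr_ge0 // mulr_ge0 // exprn_ge0.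
  + by move=> Q l w; apply: longarm_decoupled => // a; exact: indic3E.
Qed.
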